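(* Let $E/\mathbb Q(t)$ be the elliptic curve $y^2=x^3-t^2x+t^2$. Let $t_0\in\mathbb N$ with $t_0>1$ and $t_0\equiv 1\pmod 4$. Then the specialization map $\sigma_{t_0}:E(\mathbb Q(t))\to E_{t_0}(\mathbb Q)$ is injective.
   Context: $E_{t_0}$ is the elliptic curve $y^2=x^3-t_0^2x+t_0^2$ over $\mathbb Q$ and $\sigma_{t_0}$ is the specialization homomorphism $(x(t),y(t))\mapsto(x(t_0),y(t_0))$. *)

(* Defs.v *)
From HB Require Import structures.
From mathcomp Require Import all_boot all_order all_algebra.
From mathcomp Require Import fraction.
Set Implicit Arguments. Unset Strict Implicit. Unset Printing Implicit Defensive.
Import Order.TTheory GRing.Theory Num.Theory.
Local Open Scope ring_scope.

Definition Qt := {fraction {poly rat}}.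
Definition tQ : Qt := tofrac ('X : {poly rat}).

(* Points of an elliptic curve y^2 = x^3 + a x + b over a field K, in
   affine coordinates; None is the point at infinity O. *)
Definition on_curve (K : fieldType) (a b : K) (P : option (K * K)) : Prop :=
  match P with
  | None => True
  | Some (x, y) => y ^+ 2 = x ^+ 3 + a * x + b
  end.

Definition E_Qt (P : option (Qt * Qt)) : Prop :=
  on_curve (- tQ ^+ 2) (tQ ^+ 2) P.

Definition E_spec (t0 : rat) (P : option (rat * rat)) : Prop :=
  on_curve (- t0 ^+ 2) (t0 ^+ 2) P.

Definition value_at (t0 : rat) (f : Qt) (c : rat) : Prop :=
  exists p q : {poly rat},
    q.[t0] != 0 /\ f = tofrac p / tofrac q /\ c = p.[t0] / q.[t0].

Definition regular_at (t0 : rat) (f : Qt) : Prop := exists c, value_at t0 f c.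

(* Graph of the specialization map sigma_{t0} : E(Q(t)) -> E_{t0}(Q):
   O |-> O; (x(t),y(t)) |-> (x(t0),y(t0)) if x has no pole at t0,
   and |-> O if x has a pole at t0 (reduction of points at t = t0). *)
Definition spec_rel (t0 : rat) (P : option (Qt * Qt)) (R : option (rat * rat))
  : Prop :=
  match P, R with
  | None, None => True
  | None, Some _ => False
  | Some (x, y), None => ~ regular_at t0 x
  | Some (x, y), Some (a, b) => value_at t0 x a /\ value_at t0 y b
  end.

(* Main.v *)
(** Let theta be a root of X^3 - t^2 X + t^2 over Q(t). The field Q(t)(theta) is the
    rational function field Q(w), with t = w^3/(w^2 - 1) and theta = w^2/(w^2 - 1), so
    2-descent takes place in Q[w]: for a point (x, y) of E(Q(t)), x - theta equals
    c (w - 1)^k (w + 1)^l up to a square, with c rational and k, l in {0, 1}. If (x, y)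
    reduces to O at t0, specializing w to the roots of w^3 - t0 w^2 + t0 would make one
    of the units 1 - w, 1 + w, 1 - w^2 a square unless k = l = 0, and the congruence
    t0 = 1 mod 4 together with t0 > 1 excludes that. Hence x - theta is a square and
    (x, y) = 2 Q, where Q again reduces to O because x^3 - t0^2 x + t0^2 has no rational
    root. Halving twice strictly lowers the degree of the denominator of x, so by
    infinite descent no affine point reduces to O. Finally, if P1 and P2 have the same
    affine reduction and P1 <> P2, then P2 - P1 would be an affine point reducing to O. *)
Require Import Defs.
From HB Require Import structures.
From mathcomp Require Import all_boot all_order all_algebra all_field.
From mathcomp Require Import fraction ring lra zify.
Set Implicit Arguments. Unset Strict Implicit. Unset Printing Implicit Defensive.
Import Order.TTheory GRing.Theory Num.Theory.
Local Open Scope ring_scope.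

(** * Values at t0 and points in lowest terms *)

Lemma value_at_uniq (t : rat) (f : Qt) (c d : rat) :
  value_at t f c -> value_at t f d -> c = d.
Proof.
move=> [p [q [q0 [-> ->]]]] [p' [q' [q'0 [E ->]]]].
have nz (r : {poly rat}) : r.[t] != 0 -> tofrac r != 0.
  by rewrite tofrac_eq0; apply: contra_neq => ->; rewrite horner0.
move/eqP: E; rewrite eqr_div ?nz // -!tofracM tofrac_eq => /eqP/(congr1 (horner^~ t)).
by rewrite !hornerM => E; apply/eqP; rewrite eqr_div // E.
Qed.

Lemma value_atD (t : rat) (f g : Qt) (c d : rat) :
  value_at t f c -> value_at t g d -> value_at t (f + g) (c + d).
Proof.
move=> [p [q [q0 [-> ->]]]] [p' [q' [q'0 [-> ->]]]].
have nz (r : {poly rat}) : r.[t] != 0 -> tofrac r != 0.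
  by rewrite tofrac_eq0; apply: contra_neq => ->; rewrite horner0.
exists (p * q' + p' * q), (q * q'); rewrite !hornerE mulf_neq0 //; split=> //.
by split; rewrite addf_div ?nz // !(tofracD, tofracM).
Qed.

Lemma value_atM (t : rat) (f g : Qt) (c d : rat) :
  value_at t f c -> value_at t g d -> value_at t (f * g) (c * d).
Proof.
move=> [p [q [q0 [-> ->]]]] [p' [q' [q'0 [-> ->]]]].
exists (p * p'), (q * q'); rewrite !hornerM mulf_neq0 //; split=> //.
by split; rewrite ?tofracM mulf_div.
Qed.

Lemma value_at_poly (t : rat) (p : {poly rat}) : value_at t (tofrac p) p.[t].
Proof. by exists p, 1; rewrite !hornerE tofrac1 !divr1 oner_neq0. Qed.

Lemma value_atN (t : rat) (f : Qt) (c : rat) :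
  value_at t f c -> value_at t (- f) (- c).
Proof.
move=> h; rewrite -mulN1r -[- c]mulN1r; apply: value_atM h.
have -> : -1 = tofrac (-1) :> Qt by rewrite tofracN tofrac1.
by have := value_at_poly t (-1); rewrite !hornerE.
Qed.

Lemma value_atX (t : rat) (f : Qt) (c : rat) n :
  value_at t f c -> value_at t (f ^+ n) (c ^+ n).
Proof.
move=> h; elim: n => [|n IH]; last by rewrite !exprS; apply: value_atM.
by have := value_at_poly t 1; rewrite tofrac1 hornerE.
Qed.

(* The affine point (A/D^2, B/D^3) in lowest terms. *)
Definition reduced_point (R : fieldType) (A B D : {poly R}) : Prop :=
  [/\ D != 0, coprimep A D
    & B ^+ 2 = A ^+ 3 - 'X ^+ 2 * A * D ^+ 4 + 'X ^+ 2 * D ^+ 6].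

Lemma fraction_coprime (R : fieldType) (f : {fraction {poly R}}) :
  exists p q : {poly R}, [/\ q != 0, coprimep p q & f = tofrac p / tofrac q].
Proof.
have [p [q [q0 ->]]] : exists p q : {poly R}, q != 0 /\ f = tofrac p / tofrac q.
  elim/quotW: f => r; exists r.1, r.2; split; first exact: denom_ratioP.
  have h : (tofrac r.2 : {fraction {poly R}}) != 0.
    by rewrite tofrac_eq0 denom_ratioP.
  apply: (mulIf h); rewrite divfK // /tofrac; unlock FracField.tofrac.
  rewrite -[LHS]FracField.pi_mul; apply/eqmodP; rewrite /= FracField.equivfE.
  by rewrite /FracField.mulf !numden_Ratio ?mulf_neq0 ?oner_neq0 ?denom_ratioP // !mulr1 mulrC.
have g0 : gcdp p q != 0 by rewrite gcdp_eq0 negb_and q0 orbT.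
exists (p %/ gcdp p q), (q %/ gcdp p q); split.
- by rewrite divpN0 // ?leq_divpl// dvdp_leq ?dvdp_gcdr.
- by rewrite coprimep_div_gcd // q0 orbT.
- have := divpK (dvdp_gcdl p q); have := divpK (dvdp_gcdr p q).
  move: g0; set g := gcdp p q; set a := p %/ _; set b := q %/ _.
  move: g a b => g a b g0 <- <-.
  by rewrite !tofracM -mulf_div divff ?mulr1 // tofrac_eq0.
Qed.

(** Since q^2 divides p^2, q divides p. Applied to the denominators p of y and q of x, this makes
    the denominator of x a square up to a constant. *)
Lemma dvdp_sqr_scale (R : fieldType) (p q : {poly R}) (c : R) :
  c != 0 -> q != 0 -> p ^+ 2 = c *: q ^+ 3 ->
  exists2 r, p = r * q & r ^+ 2 = c *: q.
Proof.
move=> c0 q0 E.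
have /dvdpP[r Er] : q %| p.
  by rewrite -(dvdp_pexp2r q p (ltn0Sn 1)) E dvdpZr // dvdp_exp2l.
exists r => //; apply: (mulIf (expf_neq0 2 q0)).
by rewrite -exprMn -Er E exprS scalerAl.
Qed.

Lemma eqf_rational_point (F : fieldType) (a b p q u v : F) :
  q != 0 -> v != 0 -> (u / v) ^+ 2 = (p / q) ^+ 3 + a * (p / q) + b ->
  u ^+ 2 * q ^+ 3 = v ^+ 2 * (p ^+ 3 + a * p * q ^+ 2 + b * q ^+ 3).
Proof.
move=> q0 v0 E.
have -> : u ^+ 2 = (u / v) ^+ 2 * v ^+ 2 by field.
by rewrite E; field.
Qed.

(** Write x = p/q and y = u/v in lowest terms. Coprimality makes v^2 and q^3 associates, so D = v/q
    satisfies D^2 = c q for a constant c, and A = c p, B = c u absorb it. *)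
Lemma reduced_pointP (x y : Qt) :
  E_Qt (Some (x, y)) ->
  exists A B D, [/\ reduced_point A B D, x = tofrac A / tofrac D ^+ 2
                  & y = tofrac B / tofrac D ^+ 3].
Proof.
rewrite /E_Qt /on_curve.
have [p [q [q0 cpq ->]]] := fraction_coprime x.
have [u [v [v0 cuv ->]]] := fraction_coprime y.
have tf (r : {poly rat}) : r != 0 -> tofrac r != 0 by rewrite tofrac_eq0.
move/(eqf_rational_point (tf _ q0) (tf _ v0)).
rewrite /tQ -!(tofracXn, tofracN, tofracM, tofracD) => /eqP; rewrite tofrac_eq => /eqP E.
set w := (p ^+ 3 + _ + _) in E.
have cqw : coprimep (q ^+ 3) w.
  apply: coprimep_expl; rewrite /w -addrA -['X^2 * _]mulrC.
  have -> : p ^+ 3 + (- 'X^2 * p * q ^+ 2 + q ^+ 3 * 'X^2)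
     = p ^+ 3 + (- 'X^2 * p * q + q ^+ 2 * 'X^2) * q by ring.
  by rewrite -coprimep_modr modpD modp_mull addr0 coprimep_modr coprimep_expr // coprimep_sym.
have : v ^+ 2 %= q ^+ 3.
  rewrite /eqp; apply/andP; split.
    have cvu : coprimep (v ^+ 2) (u ^+ 2).
      by apply/coprimep_expl/coprimep_expr; rewrite coprimep_sym.
    by rewrite -(Gauss_dvdpr _ cvu) E dvdp_mulr.
  by rewrite -(Gauss_dvdpl _ cqw) -E dvdp_mull.
move/eqpP => [[c1 c2] /= /andP[c10 c20] Ec].
have Ev : v ^+ 2 = (c2 / c1) *: q ^+ 3.
  by rewrite mulrC -scalerA -Ec scalerA mulVf // scale1r.
have c0 : c2 / c1 != 0 by rewrite mulf_neq0 ?invr_eq0.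
have [r Er Er2] := dvdp_sqr_scale c0 q0 Ev.
move: (c2 / c1) c0 Ev Er2 => c c0 Ev Er2.
have r0 : r != 0 by apply: contra_neq v0 => r0; rewrite Er r0 mul0r.
exists (c *: p), (c *: u), r; split.
- split=> //.
    by rewrite coprimepZl // -(coprimep_pexpr _ _ (ltn0Sn 1)) Er2 coprimepZr.
  have Ecu : u ^+ 2 = c *: w.
    apply: (mulIf (expf_neq0 3 q0)); rewrite E Ev -!mul_polyC; ring.
  have -> : r ^+ 4 = (c *: q) ^+ 2 by rewrite -Er2 -exprM.
  have -> : r ^+ 6 = (c *: q) ^+ 3 by rewrite -Er2 -exprM.
  rewrite exprZn Ecu /w -!mul_polyC rmorphXn /=; ring.
- apply/eqP; rewrite -tofracXn eqr_div ?tf ?expf_neq0 // -!tofracM Er2 tofrac_eq.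
  by rewrite -scalerAl -scalerAr.
- apply/eqP; rewrite -tofracXn eqr_div ?tf ?expf_neq0 // -!tofracM tofrac_eq Er.
  by rewrite exprSr Er2 -!mul_polyC; apply/eqP; ring.
Qed.

(** * Degrees of doubled points *)

Lemma reduced_point_coprime (R : realFieldType) (A B D : {poly R}) :
  reduced_point A B D -> coprimep B D.
Proof.
move=> [_ cAD E]; rewrite -(coprimep_pexpl _ _ (ltn0Sn 1)) E coprimep_sym.
have -> : A ^+ 3 - 'X ^+ 2 * A * D ^+ 4 + 'X ^+ 2 * D ^+ 6
  = A ^+ 3 + ('X ^+ 2 * D ^+ 5 - 'X ^+ 2 * A * D ^+ 3) * D by ring.
rewrite -coprimep_modr modpD modp_mull addr0 coprimep_modr.
by rewrite coprimep_expr // coprimep_sym.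
Qed.

(* x(2Q) = ((x^2 + t^2)^2 - 8 t^2 x) / (4 y^2), homogenised at x = A/D^2. *)
Definition double_num (R : realFieldType) (A D : {poly R}) : {poly R} :=
  (A ^+ 2 + ('X * D ^+ 2) ^+ 2) ^+ 2 - 8%:R * 'X ^+ 2 * A * D ^+ 6.

Definition is_double (R : realFieldType) (A D A' B' D' : {poly R}) : Prop :=
  4%:R * A * D' ^+ 2 * B' ^+ 2 = D ^+ 2 * double_num A' D'.

(** Leading coefficients of squares are nonnegative, so they cannot cancel. *)
Lemma size_add_sqr (R : realDomainType) (p q : {poly R}) :
  (size (p ^+ 2) <= size (p ^+ 2 + q ^+ 2)%R)%N.
Proof.
case: (ltngtP (size (p ^+ 2)) (size (q ^+ 2))) => [lt|gt|E].
- by rewrite addrC size_polyDl // ltnW.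
- by rewrite size_polyDl.
have [->|p0] := eqVneq p 0; first by rewrite expr0n size_poly0.
have sp : (0 < size (p ^+ 2))%N by rewrite size_poly_gt0 expf_neq0.
rewrite leqNgt; apply/negP => lt.
have : (p ^+ 2 + q ^+ 2)`_(size (p ^+ 2)).-1 = 0.
  by apply: nth_default; rewrite -ltnS prednK.
rewrite coefD {2}E -!lead_coefE !lead_coef_exp => /eqP.
by rewrite paddr_eq0 ?sqr_ge0 // expf_eq0 lead_coef_eq0 (negbTE p0).
Qed.

(* Restated over a [realFieldType] because [lia] identifies two sizes only when their
   ring structures agree syntactically. *)
Lemma size_exp_real (R : realFieldType) (p : {poly R}) n :
  p != 0 -> size (p ^+ n) = ((size p).-1 * n).+1.
Proof.
move=> p0; have e : (size (p ^+ n)).-1 = ((size p).-1 * n)%N by apply: size_exp.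
by rewrite -e prednK // size_poly_gt0 expf_neq0.
Qed.

Lemma size_exp_real_leq (R : realFieldType) (p : {poly R}) n :
  (size (p ^+ n) <= ((size p).-1 * n).+1)%N.
Proof. exact: size_poly_exp_leq. Qed.

Lemma size_mul_real_leq (R : realFieldType) (p q : {poly R}) :
  (size (p * q)%R <= (size p + size q).-1)%N.
Proof. exact: size_polyMleq. Qed.

(** The square of A^2 + t^2 D^4 has degree at least max(4 deg A, 8 deg D + 4), which exceeds 2 + deg
    A + 6 deg D, a bound for the subtracted term. *)
Lemma size_double_num (R : realFieldType) (A D : {poly R}) :
  D != 0 -> (8 * (size D).-1 + 4 < size (double_num A D))%N.
Proof.
move=> D0; rewrite /double_num.
have sD : (0 < size D)%N by rewrite size_poly_gt0.
set S := A ^+ 2 + _.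
have h1 : (size (A ^+ 2) <= size S)%N by apply: size_add_sqr.
have h2 : (size (('X * D ^+ 2) ^+ 2) <= size S)%N.
  by rewrite /S addrC size_add_sqr.
have D20 : D ^+ 2 != 0 by rewrite expf_neq0.
have E2 : size (('X * D ^+ 2) ^+ 2) = (4 * (size D).-1 + 3)%N.
  rewrite size_exp_real ?mulf_neq0 ?polyX_eq0 // mulrC size_mulX //.
  by rewrite size_exp_real //; lia.
have S0 : S != 0 by rewrite -size_poly_gt0; lia.
have sS2 := size_exp_real 2 S0.
have lt : (size (8%:R * 'X ^+ 2 * A * D ^+ 6)%R < size (S ^+ 2))%N.
  have [A0|A0] := eqVneq A 0.
    by rewrite A0 mulr0 mul0r size_poly0 sS2; lia.
  have sA : (0 < size A)%N by rewrite size_poly_gt0.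
  have sA2 := size_exp_real 2 A0.
  have b1 : (size (8%:R * 'X ^+ 2 : {poly R})%R <= 3)%N.
    rewrite -[8%:R](rmorph_nat (@polyC R)) mul_polyC -(size_polyXn R 2).
    exact: size_scale_leq.
  have b2 := size_mul_real_leq (8%:R * 'X ^+ 2) A.
  have b3 := size_mul_real_leq (8%:R * 'X ^+ 2 * A) (D ^+ 6).
  have b4 := size_exp_real_leq D 6.
  by rewrite sS2; lia.
rewrite size_polyDl ?size_polyN // sS2; lia.
Qed.

(** A Bezout combination of the duplication numerator and the cubic equals, up to sign, D^12 times
    the discriminant t^4 (4 t^2 - 27) of the cubic. As B is coprime to D, B^2 divides this
    discriminant, of degree 6. *)
Lemma size_ordinate (R : realFieldType) (A B D : {poly R}) :
  reduced_point A B D -> B != 0 -> B ^+ 2 %| double_num A D -> (size B <= 4)%N.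
Proof.
move=> rp B0 dvd; have [D0 cAD E] := rp.
have cBD := reduced_point_coprime rp.
have : B ^+ 2 %| ('X ^+ 4 * (27%:R - 4%:R * 'X ^+ 2)) * D ^+ 12.
  have -> : ('X ^+ 4 * (27%:R - 4%:R * 'X ^+ 2)) * D ^+ 12 =
    (3%:R * A ^+ 2 - 4%:R * 'X ^+ 2 * D ^+ 4) * double_num A D
    - (3%:R * A ^+ 3 + 5%:R * 'X ^+ 2 * A * D ^+ 4 - 27%:R * 'X ^+ 2 * D ^+ 6)
      * B ^+ 2 by rewrite E /double_num; ring.
  by rewrite dvdp_sub // dvdp_mull.
rewrite Gauss_dvdpl; last by rewrite coprimep_expl // coprimep_expr.
have sz : size ('X ^+ 4 * (27%:R - 4%:R * 'X ^+ 2) : {poly R}) = 7%N.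
  have -> : 'X ^+ 4 * (27%:R - 4%:R * 'X ^+ 2) =
     'X^4 * (27%:P + (- 4%:P) * 'X^2) :> {poly R} by rewrite !rmorph_nat; ring.
  rewrite -polyCN mul_polyC addrC mulrC.
  have e : size ((- 4%:R : R) *: 'X^2 + 27%:R%:P) = 3%N.
    have n4 : (- 4%:R : R) != 0 by rewrite oppr_eq0 pnatr_eq0.
    rewrite size_polyDl ?size_scale ?size_polyXn //.
    exact: leq_ltn_trans (size_polyC_leq1 _) _.
  by rewrite size_mulXn ?e // -size_poly_gt0 e.
move/(dvdp_leq _); rewrite -size_poly_gt0 sz => /(_ isT).
by rewrite size_exp_real //; lia.
Qed.

(** The factor [D'] of the denominator of x(2Q) is coprime to the numerator, hence survives in [D].
    The cofactor [E] is coprime to [A], so E^2 divides B'^2. *)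
Lemma is_double_dvd (R : realFieldType) (A B D A' B' D' : {poly R}) :
  reduced_point A B D -> reduced_point A' B' D' -> is_double A D A' B' D' ->
  exists E, [/\ D = D' * E, E %| B' & 4%:R * A * B' ^+ 2 = E ^+ 2 * double_num A' D'].
Proof.
move=> rp rp' H; have [D0 cAD _] := rp; have [D'0 cAD' _] := rp'.
have cF : coprimep (D' ^+ 2) (double_num A' D').
  apply: coprimep_expl; rewrite /double_num.
  have -> : (A' ^+ 2 + ('X * D' ^+ 2) ^+ 2) ^+ 2 - 8%:R * 'X ^+ 2 * A' * D' ^+ 6
    = A' ^+ 4 + (2%:R * A' ^+ 2 * 'X ^+ 2 * D' ^+ 3 + 'X ^+ 4 * D' ^+ 7
       - 8%:R * 'X ^+ 2 * A' * D' ^+ 5) * D' by ring.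
  rewrite -coprimep_modr modpD modp_mull addr0 coprimep_modr.
  by rewrite coprimep_expr // coprimep_sym.
have /dvdpP[E ED] : D' %| D.
  rewrite -(dvdp_pexp2r _ _ (ltn0Sn 1)) -(Gauss_dvdpl _ cF) -H.
  by rewrite dvdp_mulr // dvdp_mull.
have E4 : 4%:R * A * B' ^+ 2 = E ^+ 2 * double_num A' D'.
  apply: (mulIf (expf_neq0 2 D'0)); transitivity (4%:R * A * D' ^+ 2 * B' ^+ 2).
    by ring.
  by rewrite H ED; ring.
exists E; split=> //; first by rewrite mulrC.
rewrite -(dvdp_pexp2r _ _ (ltn0Sn 1)).
have cEA : coprimep (E ^+ 2) A.
  apply: coprimep_expl; have dE : E %| D by rewrite ED dvdp_mulIl.
  by rewrite (coprimep_dvdr dE) // coprimep_sym.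
rewrite -(Gauss_dvdpr _ cEA).
have c4 : (4%:R : R) != 0 by rewrite pnatr_eq0.
by rewrite -(dvdpZr _ _ c4) -mul_polyC rmorph_nat mulrA E4 dvdp_mulr.
Qed.

Lemma const_scaled_double (R : realFieldType) (E A B F : {poly R}) :
  size E = 1 -> 4%:R * A * B ^+ 2 = E ^+ 2 * F ->
  B ^+ 2 %| F /\ (B != 0 -> F != 0 -> size F = (size A + (size B).-1 * 2)%N).
Proof.
have c4 : (4%:R : R) != 0 by rewrite pnatr_eq0.
move=> /eqP/size_poly1P[e e0 ->]; rewrite -polyC_exp mul_polyC => EF.
have e2 : e ^+ 2 != 0 by rewrite expf_neq0.
split; first by rewrite -(dvdpZr _ _ e2) -EF dvdp_mull.
move=> nB nF; have := size_scale F e2; rewrite -EF => <-.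
have nA : A != 0.
  apply: contra_neq nF => zA; apply/eqP.
  by rewrite -size_poly_eq0 -(size_scale _ e2) -EF zA mulr0 mul0r size_poly0.
rewrite -mulrA -[4%:R](rmorph_nat (@polyC R)) mul_polyC size_scale //.
by rewrite size_mul ?expf_neq0 // size_exp_real // addnS.
Qed.

(* If the denominators of 4Q, 2Q and Q have equal degrees, then y(2Q) and y(Q)
   can only vanish on the discriminant, hence have small degree, which makes the
   degree of the numerator of x(2Q), and therefore that of y(2Q), too large. *)
Lemma double_size_denominator (R : realFieldType) (A0 B0 D0 A1 B1 D1 A2 B2 D2 : {poly R}) :
  reduced_point A0 B0 D0 -> reduced_point A1 B1 D1 -> reduced_point A2 B2 D2 ->
  is_double A0 D0 A1 B1 D1 -> is_double A1 D1 A2 B2 D2 ->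
  B1 != 0 -> B2 != 0 -> (1 < size D2)%N -> (size D2 < size D0)%N.
Proof.
move=> r0 r1 r2 d01 d12 nB1 nB2 sD2; rewrite ltnNge; apply/negP => le.
have [E1 [ED0 E1B E41]] := is_double_dvd r0 r1 d01.
have [E2 [ED1 E2B E42]] := is_double_dvd r1 r2 d12.
have [nD0 _ _] := r0; have [nD1 _ Eq1] := r1; have [nD2 _ _] := r2.
have nE1 : E1 != 0 by apply: contra_neq nD0 => h; rewrite ED0 h mulr0.
have nE2 : E2 != 0 by apply: contra_neq nD1 => h; rewrite ED1 h mulr0.
have g1 : (0 < size E1)%N by rewrite size_poly_gt0.
have g2 : (0 < size E2)%N by rewrite size_poly_gt0.
have s0 : size D0 = (size D1 + size E1).-1 by rewrite ED0 size_mul.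
have s1 : size D1 = (size D2 + size E2).-1 by rewrite ED1 size_mul.
have e1 : size E1 = 1 by clear -s0 s1 g1 g2 le; lia.
have e2 : size E2 = 1 by clear -s0 s1 g1 g2 le; lia.
have [dB1 _] := const_scaled_double e1 E41.
have [dB2 sF] := const_scaled_double e2 E42.
have b1 := size_ordinate r1 nB1 dB1.
have b2 := size_ordinate r2 nB2 dB2.
have bF := size_double_num A2 nD2.
have F0 : double_num A2 D2 != 0 by rewrite -size_poly_gt0; clear -bF; lia.
have {}sF := sF nB2 F0.
(* No cancellation occurs, so deg A1 is the degree of the duplication numerator, at least 8 deg D2 +
   4, minus 2 deg B2, which is at most 6. *)
have sA1 : (8 * (size D1).-1 < size A1 + 2)%N.
  by clear -bF sF b2 s0 s1 g1 g2 le; lia.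
have sD1 : (1 < size D1)%N by clear -s0 s1 g1 g2 le sD2; lia.
have nA1 : A1 != 0 by rewrite -size_poly_gt0; clear -sA1 sD1; lia.
have sA3 := size_exp_real 3 nA1.
have u1 : (size ('X ^+ 2 * A1 * D1 ^+ 4)%R < size (A1 ^+ 3))%N.
  have := size_mul_real_leq ('X ^+ 2 * A1) (D1 ^+ 4).
  have := size_mul_real_leq ('X ^+ 2) A1; rewrite size_polyXn.
  have := size_exp_real_leq D1 4; clear -sA1 sA3 sD1; lia.
have u2 : (size ('X ^+ 2 * D1 ^+ 6)%R < size (A1 ^+ 3))%N.
  have := size_mul_real_leq ('X ^+ 2) (D1 ^+ 6); rewrite size_polyXn.
  have := size_exp_real_leq D1 6; clear -sA1 sA3 sD1; lia.
have u3 : size (B1 ^+ 2) = size (A1 ^+ 3).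
  rewrite Eq1 -addrA size_polyDl // (leq_ltn_trans (size_polyD _ _)) //.
  by rewrite gtn_max size_polyN u1.
(* B1^2 has degree 3 deg A1 >= 18, but deg B1 <= 3. *)
have := size_exp_real_leq B1 2; clear -u3 sA3 sA1 sD1 b1; lia.
Qed.

(** * Integers and rationals *)

(** For odd t0 the cubic is X^3 + X + 1 modulo 2, so a root n/D would have n and D both even. *)
Lemma cubic_no_rational_root (t0 : nat) (r : rat) :
  odd t0 -> r ^+ 3 - t0%:R ^+ 2 * r + t0%:R ^+ 2 != 0.
Proof.
move=> ot; apply/eqP.
have D0 : (denq r)%:~R != 0 :> rat by rewrite intr_eq0 denq_neq0.
have cnd := coprime_num_den r; move=> E.
rewrite -[r]divq_num_den in E; move: (numq r) (denq r) D0 cnd E => n D D0 cnd E.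
have {}E : n ^+ 3 - t0%:Z ^+ 2 * n * D ^+ 2 + t0%:Z ^+ 2 * D ^+ 3 = 0.
  apply: (@intr_inj rat); rewrite !(rmorphD, rmorphN, rmorphM, rmorphXn) /= rmorph0.
  rewrite -[RHS](mul0r (D%:~R ^+ 3)) -E.
  by rewrite -[(t0%:Z)%:~R]/(t0%:R); field.
have [j ej] : exists j : int, t0%:Z = 2 * j + 1.
  exists (t0./2)%:Z; have := odd_double_half t0; rewrite ot -mul2n; lia.
have [a [i [ea hi]]] : exists (a i : int), n = 2 * a + i /\ (i = 0 \/ i = 1).
  exists (n %/ 2)%Z, (n %% 2)%Z; lia.
have [b [k [eb hk]]] : exists (b k : int), D = 2 * b + k /\ (k = 0 \/ k = 1).
  exists (D %/ 2)%Z, (D %% 2)%Z; lia.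
have [n2 D2] : i = 0 /\ k = 0.
  move: E; rewrite ej ea eb !exprS !expr0.
  by case: hi => ->; case: hk => ->; lia.
move: cnd; rewrite /coprime -dvdn1 => h.
have : (2 %| 1)%N by apply: dvdn_trans h; rewrite dvdn_gcd; lia.
by [].
Qed.

Lemma monic_quartic_int_root (a : rat) (p q r : int) :
  a ^+ 4 + p%:~R * a ^+ 2 + q%:~R * a + r%:~R = 0 ->
  exists2 z : int, a = z%:~R & z ^+ 4 + p * z ^+ 2 + q * z + r = 0.
Proof.
have D0 : (denq a)%:~R != 0 :> rat by rewrite intr_eq0 denq_neq0.
have cnd := coprime_num_den a; have Dgt0 := denq_gt0 a; move=> E.
rewrite -[a]divq_num_den in E *.
move: (numq a) (denq a) D0 Dgt0 cnd E => n D D0 Dgt0 cnd E.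
have {}E : n ^+ 4 + p * n ^+ 2 * D ^+ 2 + q * n * D ^+ 3 + r * D ^+ 4 = 0.
  apply: (@intr_inj rat); rewrite !(rmorphD, rmorphM, rmorphXn) /= rmorph0.
  by rewrite -[RHS](mul0r (D%:~R ^+ 4)) -E; field.
have D1 : D = 1.
  have dv : (D %| n ^+ 4)%Z.
    apply/dvdzP; exists (- (p * n ^+ 2 * D + q * n * D ^+ 2 + r * D ^+ 3)).
    by apply/eqP; rewrite -subr_eq0; apply/eqP; rewrite -[RHS]E; ring.
  have : coprimez D (n ^+ 4) by rewrite coprimezXr // coprimezE coprime_sym.
  rewrite coprimezE => c; move: dv; rewrite dvdzE => dv.
  by move: (coprime_dvdr dv c); rewrite /coprime gcdnn; lia.
exists n; first by rewrite D1 divr1.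
by move: E; rewrite D1 !expr1n !mulr1.
Qed.

Lemma int_parity (z : int) : exists y, z = 2 * y \/ z = 2 * y + 1.
Proof. by exists (z %/ 2)%Z; lia. Qed.

(* The characteristic polynomials of 1 - w, 1 + w and 1 - w^2, where
   w^3 - t w^2 + t = 0, are X^3 - m1 X^2 + m2 X - 1 for the pairs (m1, m2) below.
   If b is a square root of one of these units with trace z and norm e, then z is a
   root of the quartic (z^2 - m1)^2 = 8 e z + 4 m2. *)
Lemma quartic_1subw (t z e : int) : 5%:Z <= t -> e ^+ 2 = 1 ->
  (z ^+ 2 - (3 - t)) ^+ 2 != 8 * e * z + 4 * (3 - 2 * t).
Proof.
move=> t5 /eqP; rewrite sqrf_eq1 => he.
suff main (y : int) : (y ^+ 2 - (3 - t)) ^+ 2 != 8 * y + 4 * (3 - 2 * t).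
  case/orP: he => /eqP->; first by rewrite mulr1.
  by have := main (- z); rewrite sqrrN mulrN1 mulNr mulrN.
(* (y + 1)^3 (y - 3) + 2 (y^2 + 1) t + t^2 > 0 *)
rewrite neq_lt; apply/orP; right; rewrite -subr_gt0.
nia.
Qed.

(** For odd z the two sides differ in parity; for even z they are 0 and 4 modulo 16. *)
Lemma quartic_1addw (t z e : int) : (4 %| t - 1)%Z -> e ^+ 2 = 1 ->
  (z ^+ 2 - (3 + t)) ^+ 2 != 8 * e * z + 4 * (3 + 2 * t).
Proof.
move=> /dvdzP[j hj] /eqP; rewrite sqrf_eq1 => he; apply/eqP.
have -> : t = 4 * j + 1 by lia.
have [y [->|->]] := int_parity z; rewrite !expr2; case/orP: he => /eqP->; lia.
Qed.

(** For odd z the two sides differ in parity; for even z they are 4 and 12 modulo 16. *)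
Lemma quartic_1subw2 (t z e : int) : (4 %| t - 1)%Z -> e ^+ 2 = 1 ->
  (z ^+ 2 - (3 - t ^+ 2)) ^+ 2 != 8 * e * z + 4 * 3.
Proof.
move=> /dvdzP[j hj] /eqP; rewrite sqrf_eq1 => he; apply/eqP.
have -> : t = 4 * j + 1 by lia.
have [y [->|->]] := int_parity z; rewrite !expr2; case/orP: he => /eqP->; lia.
Qed.

(** * The embedding of Q(t) into Q(w) *)

(* Locked, so that the rewrite rules for sums do not see through the name. *)
Definition sw : {poly rat} := locked ('X ^+ 2 - 1).

Lemma swE : sw = 'X ^+ 2 - 1.
Proof. by rewrite /sw -lock. Qed.

(* [homog N p] is (w^2 - 1)^N p(w^3 / (w^2 - 1)). *)
Definition homog (N : nat) (p : {poly rat}) : {poly rat} :=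
  \sum_(i < N.+1) p`_i *: (('X ^+ 3) ^+ i * sw ^+ (N - i)).

(** The target ring is arbitrary so that this serves both the generic w in Q(w) and the roots of w^3
    = t0 (w^2 - 1) in [algC]. *)
Lemma homog_eval (L : comNzRingType) (f : {rmorphism rat -> L}) (w t : L)
    (N : nat) (p : {poly rat}) :
  (size p <= N.+1)%N -> w ^+ 3 = t * (w ^+ 2 - 1) ->
  (map_poly f (homog N p)).[w] = (w ^+ 2 - 1) ^+ N * (map_poly f p).[t].
Proof.
move=> sp ew; rewrite /homog rmorph_sum /= horner_sum.
rewrite (@horner_coef_wide _ N.+1); last exact: leq_trans (size_poly _ _) sp.
rewrite mulr_sumr; apply: eq_bigr => i _.
rewrite map_polyZ rmorphM !rmorphXn swE rmorphB rmorph1 rmorphXn /= !map_polyX.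
rewrite !hornerE /= coef_map ew exprMn.
have -> : (w ^+ 2 - 1) ^+ N = (w ^+ 2 - 1) ^+ (N - i) * (w ^+ 2 - 1) ^+ i.
  by rewrite -exprD subnK // -ltnS.
by ring.
Qed.

Definition fracC : {rmorphism rat -> Qt} := (@tofrac _ : {poly rat} -> Qt) \o polyC.

Lemma fracC_eval (p : {poly rat}) : (map_poly fracC p).[tofrac 'X] = tofrac p.
Proof.
rewrite map_poly_comp horner_map /=; congr (tofrac _).
exact: comp_polyXr.
Qed.

Definition tau : Qt := tofrac ('X ^+ 3) / tofrac sw.

(* The embedding t |-> w^3 / (w^2 - 1) of Q[t] into Q(w). *)
Definition phi : {rmorphism {poly rat} -> Qt} := horner_eval tau \o map_poly fracC.

Lemma sw_neq0 : tofrac sw != 0 :> Qt.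
Proof. by rewrite tofrac_eq0 swE monic_neq0 // monicXnsubC. Qed.

Lemma tofrac_sw : tofrac sw = tofrac 'X ^+ 2 - 1 :> Qt.
Proof. by rewrite swE tofracB tofrac1 tofracXn. Qed.

Lemma tau_eq : tofrac 'X ^+ 3 = tau * (tofrac 'X ^+ 2 - 1) :> Qt.
Proof. by rewrite -tofrac_sw /tau divfK ?sw_neq0 // tofracXn. Qed.

Lemma homogE (N : nat) (p : {poly rat}) : (size p <= N.+1)%N ->
  tofrac (homog N p) = tofrac sw ^+ N * phi p.
Proof.
by move=> sp; rewrite -fracC_eval (homog_eval fracC sp tau_eq) -tofrac_sw.
Qed.

Lemma phiX : phi 'X = tau.
Proof. by rewrite /phi /= map_polyX /horner_eval hornerX. Qed.

Lemma phiC c : phi c%:P = tofrac c%:P.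
Proof. by rewrite /phi /= map_polyC /horner_eval hornerC. Qed.

(** Put S = gcd(G, W), G = g S and W = w S. Then g M = w^2 S with g coprime to w gives g | S, so G |
    S^2; conversely S^2 divides G M and is coprime to M. *)
Lemma coprime_mul_sqr (F : fieldType) (G M W : {poly F}) :
  W != 0 -> coprimep G M -> G * M = W ^+ 2 -> exists c S, G = c *: S ^+ 2.
Proof.
move=> W0 cGM E; have G0 : G != 0.
  by apply: contra_neq (expf_neq0 2 W0) => G0; rewrite -E G0 mul0r.
have S0 : gcdp G W != 0 by rewrite gcdp_eq0 negb_and G0.
have cgw : coprimep (G %/ gcdp G W) (W %/ gcdp G W).
  by rewrite coprimep_div_gcd // G0.
have := divpK (dvdp_gcdl G W); have := divpK (dvdp_gcdr G W).
move: S0 cgw; set g := G %/ _; set w := W %/ _; move: (gcdp G W) g w.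
move=> S g w S0 cgw Ew Eg.
have gS : g %| S.
  rewrite -(Gauss_dvdpr _ (coprimep_expr 2 cgw)); apply/dvdpP; exists M.
  have e : (w * S) ^+ 2 = (g * S) * M by rewrite Eg Ew E.
  apply: (mulIf S0); transitivity ((w * S) ^+ 2); first by ring.
  by rewrite e; ring.
have cSM : coprimep (S ^+ 2) M.
  by apply: coprimep_expl; apply: coprimep_dvdr cGM; rewrite -Eg dvdp_mulIr.
have : G %= S ^+ 2.
  rewrite /eqp; apply/andP; split; first by rewrite -Eg exprS expr1 dvdp_mul.
  by rewrite -(Gauss_dvdpl _ cSM) E -Ew exprMn dvdp_mulIr.
move/eqpP => [[c1 c2] /= /andP[c10 c20] Ec]; exists (c2 / c1), S.
by rewrite mulrC -scalerA -Ec scalerA mulVf // scale1r.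
Qed.

(** Homogenising a Bezout relation for A and D leaves a power of w^2 - 1 in place of 1. *)
Lemma bezout_homog (A D : {poly rat}) (n : nat) :
  coprimep A D -> (size A <= (2 * n).+1)%N -> (size D <= n.+1)%N ->
  exists a b k, a * homog (2 * n) A + b * homog n D = sw ^+ k.
Proof.
move=> /Bezout_eq1_coprimepP[[u v] /= uv] sA sD.
pose m := maxn (size u) (size v).
exists (homog m u), (homog (n + m) v), (2 * n + m)%N.
apply/eqP; rewrite -tofrac_eq tofracD !tofracM tofracXn !homogE //.
- have := congr1 phi uv; rewrite rmorphD !rmorphM rmorph1 => e.
  by apply/eqP; rewrite -[RHS]mulr1 -e mul2n -addnn !exprD; ring.
- by rewrite (leq_trans _ (leqnSn _)) // (leq_trans _ (leq_addl _ _)) // leq_maxr.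
- by rewrite (leq_trans _ (leqnSn _)) // leq_maxl.
Qed.

(** This is (x - theta)(x^2 + theta x + theta^2 - t^2) = x^3 - t^2 x + t^2 at x = a/d^2, cleared of
    denominators, with [q] standing for (w^2 - 1)^n. *)
Lemma homog_curve_identity (R : comNzRingType) (q s w t a d : R) :
  s = w ^+ 2 - 1 -> w ^+ 3 = t * (w ^+ 2 - 1) ->
  (s * (q ^+ 2 * a) - w ^+ 2 * (q * d) ^+ 2) *
  (s * (q ^+ 2 * a) ^+ 2 + w ^+ 2 * (q ^+ 2 * a) * (q * d) ^+ 2
    - w ^+ 4 * (q * d) ^+ 4) =
  (s * q ^+ 3) ^+ 2 * (a ^+ 3 - t ^+ 2 * a * d ^+ 4 + t ^+ 2 * d ^+ 6).
Proof.
move=> -> e.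
have -> : ((w ^+ 2 - 1) * q ^+ 3) ^+ 2
    * (a ^+ 3 - t ^+ 2 * a * d ^+ 4 + t ^+ 2 * d ^+ 6) =
  q ^+ 6 * ((w ^+ 2 - 1) ^+ 2 * a ^+ 3
    + (t * (w ^+ 2 - 1)) ^+ 2 * (d ^+ 6 - a * d ^+ 4)) by ring.
by rewrite -e; ring.
Qed.

Lemma homog_curve (A B D : {poly rat}) (n : nat) :
  reduced_point A B D ->
  (size A <= (2 * n).+1)%N -> (size D <= n.+1)%N -> (size B <= (3 * n).+2)%N ->
  (sw * homog (2 * n) A - 'X ^+ 2 * homog n D ^+ 2) *
  (sw * homog (2 * n) A ^+ 2 + 'X ^+ 2 * homog (2 * n) A * homog n D ^+ 2
    - 'X ^+ 4 * homog n D ^+ 4) = homog (3 * n).+1 B ^+ 2.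
Proof.
move=> [_ _ E] sA sD sB.
have {}E : phi B ^+ 2 = phi A ^+ 3 - tau ^+ 2 * phi A * phi D ^+ 4
                        + tau ^+ 2 * phi D ^+ 6.
  rewrite -phiX; move/(congr1 phi): E.
  by rewrite !(rmorphD, rmorphN, rmorphXn, rmorphM).
apply/eqP; rewrite -tofrac_eq; apply/eqP.
rewrite !(tofracD, tofracN, tofracXn, tofracM) !homogE //.
have q2 : tofrac sw ^+ (2 * n) = (tofrac sw ^+ n) ^+ 2 :> Qt by rewrite mulnC exprM.
have q3 : tofrac sw ^+ (3 * n).+1 = tofrac sw * (tofrac sw ^+ n) ^+ 3 :> Qt.
  by rewrite exprS mulnC exprM.
rewrite q2 q3 (homog_curve_identity (tofrac sw ^+ n) (phi A) (phi D) tofrac_sw tau_eq).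
by rewrite [in RHS]exprMn E.
Qed.

Lemma tau_neq0 : tau != 0.
Proof.
rewrite /tau; apply: mulf_neq0; last by rewrite invr_eq0 sw_neq0.
by rewrite tofrac_eq0 monic_neq0 // monicXn.
Qed.

Lemma coprimep_sw_X : coprimep sw 'X.
Proof. by rewrite -['X]subr0 coprimep_XsubC swE rootE !hornerE. Qed.

(** Induction on the degree in t. After clearing denominators, each positive power of t contributes
    a multiple of w^3, so w^3 divides c0 + c1 w + c2 w^2 formed by the constant terms. These vanish
    and a factor t can be removed. *)
Lemma phi_lin_indep (v0 v1 v2 : {poly rat}) :
  phi v0 + phi v1 * tofrac 'X + phi v2 * tofrac 'X ^+ 2 = 0 ->
  [/\ v0 = 0, v1 = 0 & v2 = 0].
Proof.
have [n [s0 s1 s2]] : exists n, [/\ size v0 <= n, size v1 <= n & size v2 <= n]%N.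
  exists (maxn (size v0) (maxn (size v1) (size v2))).
  by rewrite !leq_max !leqnn !orbT.
elim: n v0 v1 v2 s0 s1 s2 => [|n IH] v0 v1 v2.
  by rewrite !size_poly_leq0 => /eqP-> /eqP-> /eqP->.
have split (v : {poly rat}) : (size v <= n.+1)%N ->
    exists u c, v = u * 'X + c%:P /\ (size u <= n)%N.
  elim/poly_ind: v => [|u c _] sv.
    by exists 0, 0; rewrite mul0r add0r size_poly0.
  exists u, c; split=> //; move: sv; rewrite size_MXaddC.
  by case: eqP => [-> _|_ //]; rewrite size_poly0.
move=> /split[u0 [c0 [-> z0]]] /split[u1 [c1 [-> z1]]] /split[u2 [c2 [-> z2]]].
rewrite ![phi (_ + _)]rmorphD ![phi (_ * _)]rmorphM !phiX !phiC => E.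
pose c := c0%:P + c1%:P * 'X + c2%:P * 'X ^+ 2 : {poly rat}.
pose h := homog n u0 + homog n u1 * 'X + homog n u2 * 'X ^+ 2.
have c_eq0 : c = 0.
  have : 'X ^+ 3 %| sw ^+ n.+1 * c.
    apply/dvdpP; exists (- h); apply/eqP; rewrite mulNr -addr_eq0 -tofrac_eq0.
    rewrite /c /h !(tofracD, tofracXn, tofracM) !homogE ?(leq_trans _ (leqnSn _)) //.
    rewrite tau_eq -tofrac_sw exprS.
    apply/eqP; rewrite -[RHS](mulr0 (tofrac sw ^+ n * tofrac sw)) -E; ring.
  rewrite Gauss_dvdpr; last first.
    by apply/coprimep_expl/coprimep_expr; rewrite coprimep_sym coprimep_sw_X.
  move=> dv; apply/eqP/negPn/negP => c0'; have := dvdp_leq c0' dv.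
  rewrite size_polyXn leqNgt ltnS.
  have -> : c = \poly_(i < 3) [:: c0; c1; c2]`_i.
    by rewrite poly_def !big_ord_recl big_ord0 /= -!mul_polyC /c /bump /=; ring.
  by rewrite size_poly.
have cz i : c`_i = 0 by rewrite c_eq0 coef0.
have z : [/\ c0 = 0, c1 = 0 & c2 = 0].
  by split; [have := cz 0%N|have := cz 1%N|have := cz 2%N];
    rewrite /c !coefE /= ?mulr0 ?mul0r ?mulr1 ?addr0 ?add0r.
case: z E => -> -> ->; rewrite tofrac0 !addr0 => E.
have [] := IH u0 u1 u2 z0 z1 z2.
  by apply: (mulIf tau_neq0); rewrite mul0r -E; ring.
by move=> -> -> ->; rewrite mul0r.
Qed.

Lemma phi_eq0 p : (phi p == 0) = (p == 0).
Proof.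
apply/eqP/eqP => [e|->]; last by rewrite rmorph0.
by case: (@phi_lin_indep p 0 0); rewrite ?rmorph0 ?e ?mul0r ?addr0.
Qed.

(** * The primes w^2 - 3 of Q[w] and 4 t^2 - 27 of Q[t] *)

Lemma sqr_neq3 (x : rat) : x ^+ 2 != 3.
Proof.
have D0 : (denq x)%:~R != 0 :> rat by rewrite intr_eq0 denq_neq0.
have cnd := coprime_num_den x; apply/eqP => E.
rewrite -[x]divq_num_den in E; move: (numq x) (denq x) D0 cnd E => n D D0 cnd E.
have {}E : n * n = 3 * (D * D).
  apply: (@intr_inj rat); rewrite !rmorphM /=.
  have -> : n%:~R * n%:~R = (n%:~R / D%:~R) ^+ 2 * (D%:~R * D%:~R) :> rat by field.
  by rewrite E.
have [a [ea|ea]] := int_parity n; have [b [eb|eb]] := int_parity D.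
- have : (2 %| 1)%N by rewrite -(eqnP cnd) dvdn_gcd; lia.
  by [].
- by move: E; rewrite ea eb; lia.
- by move: E; rewrite ea eb; lia.
- by move: E; rewrite ea eb; lia.
Qed.

(** [q3] is read in the variable w and [q27] in t. They are linked by 4 t^2 - 27 = (w^2 - 3)^2 (4
    w^2 - 3) / (w^2 - 1)^2: the prime w^2 - 3 is ramified over 4 t^2 - 27. *)
Definition q3 : {poly rat} := locked ('X ^+ 2 - 3).
Definition q27 : {poly rat} := locked (4 * 'X ^+ 2 - 27).

Lemma q3E : q3 = 'X ^+ 2 - 3.
Proof. by rewrite /q3 -lock. Qed.

Lemma q27E : q27 = 4 * 'X ^+ 2 - 27.
Proof. by rewrite /q27 -lock. Qed.

Lemma size_q3 : size q3 = 3%N.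
Proof. by rewrite q3E -[3](rmorph_nat (@polyC rat)) size_XnsubC. Qed.

Lemma irreducible_q3 : irreducible_poly q3.
Proof.
apply: cubic_irreducible; first by rewrite size_q3.
by move=> x; rewrite q3E rootE -[3](rmorph_nat (@polyC rat)) !hornerE subr_eq0 sqr_neq3.
Qed.

Lemma irreducible_q27 : irreducible_poly q27.
Proof.
have e : q27 = 4%:R *: ('X^2 - (27%:R / 4%:R)%:P).
  by rewrite q27E scalerBr -!mul_polyC -polyCM [4%:R * (_ / _)]mulrC divfK // !rmorph_nat.
apply: cubic_irreducible; first by rewrite e size_scale // size_XnsubC.
move=> x; rewrite e rootZ // rootE !hornerE subr_eq0.
(* A root x has x^2 = 27/4, that is (2 x / 3)^2 = 3. *)
apply: contra (sqr_neq3 (2 * x / 3)) => /eqP h; rewrite exprMn exprMn h.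
by apply/eqP; field.
Qed.

(** * The square class of x - theta *)

(* With x = A/D^2 and theta = w^2/(w^2 - 1), a root of X^3 - t^2 X + t^2, this is
   (w^2 - 1)^(2n+1) D^2 (x - theta). *)
Definition x_sub_theta (n : nat) (A D : {poly rat}) : {poly rat} :=
  sw * homog (2 * n) A - 'X ^+ 2 * homog n D ^+ 2.

Lemma irreducible_dvdp_exp (F : fieldType) (p q : {poly F}) n :
  irreducible_poly p -> p %| q ^+ n -> p %| q.
Proof.
move=> ip; apply: contraLR; rewrite -!irreducible_poly_coprime //.
exact: coprimep_expr.
Qed.

(* Otherwise T = 4 t^2 - 27 would divide B^2 exactly once. *)
Lemma q27_ndvd (F : realFieldType) (T A B D : {poly F}) :
  T = 4 * 'X ^+ 2 - 27 -> irreducible_poly T -> reduced_point A B D ->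
  ~~ (T %| 4 * A - 6 * D ^+ 2).
Proof.
move=> ET iT [D0 cAD E]; apply/negP => /dvdpP[Q EQ].
have sT : (1 < size T)%N by case: iT.
have nT : T != 0 by rewrite -size_poly_gt0 ltnW.
(* Modulo T the cubic has the double root 3/2, and 4 A - 6 D^2 is 4 D^2 (x - 3/2). *)
have EA : 4 * A = 6 * D ^+ 2 + Q * T by rewrite -EQ; ring.
have eB : 64 * B ^+ 2 = T * (T * (- 4 * Q * D ^+ 4 + 18 * D ^+ 2 * Q ^+ 2
    + Q ^+ 3 * T) - 8 * D ^+ 6).
  transitivity ((4 * A) ^+ 3 - 16 * 'X ^+ 2 * (4 * A) * D ^+ 4
                 + 64 * 'X ^+ 2 * D ^+ 6); first by rewrite E; ring.
  by rewrite EA ET; ring.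
have dvdpMn n (p : {poly F}) : (n.+1%:R : F) != 0 -> T %| n.+1%:R * p -> T %| p.
  by move=> n0; rewrite -(rmorph_nat (@polyC F)) mul_polyC dvdpZr.
have dB : T %| B.
  apply: (irreducible_dvdp_exp (n := 2) iT); apply: (dvdpMn 63%N).
    by rewrite pnatr_eq0.
  by rewrite eB dvdp_mulIl.
have dD : T %| D.
  apply: (irreducible_dvdp_exp (n := 6) iT); apply: (dvdpMn 7%N).
    by rewrite pnatr_eq0.
  have : T * T %| 64 * B ^+ 2 by apply: dvdp_mull; rewrite expr2 dvdp_mul.
  by rewrite eB dvdp_mul2l // dvdp_subr // dvdp_mulIl.
have dA : T %| A.
  apply: (dvdpMn 3%N); first by rewrite pnatr_eq0.
  by rewrite EA dvdp_add ?dvdp_mulIr //; apply: dvdp_mull; apply: dvdp_exp.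
have : T %| gcdp A D by rewrite dvdp_gcd dA dD.
move: cAD; rewrite coprimep_def => /eqP sg /dvdp_leq.
by rewrite -size_poly_gt0 sg => /(_ isT); rewrite leqNgt sT.
Qed.

(** Split 4 (x - theta) as (4 x - 6) + (6 - 4 theta), where 6 - 4 theta = 2 (w^2 - 3) / (w^2 - 1).
    As 4 t^2 - 27 contains (w^2 - 3)^2, only the remainder r0 + r1 t matters modulo w^2 - 3. *)
Lemma x_sub_theta_mod_q3 (R : comNzRingType) (x y s w t a d q r0 r1 : R) :
  s = w ^+ 2 - 1 -> w ^+ 3 = t * (w ^+ 2 - 1) ->
  4 * a - 6 * d ^+ 2 = q * (4 * t ^+ 2 - 27) + (r0 + r1 * t) ->
  4 * (y * s ^+ 2 * (s * (x ^+ 2 * a) - w ^+ 2 * (x * d) ^+ 2)) =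
  s * x ^+ 2 * (y * q * (w ^+ 2 - 3) ^+ 2 * (4 * w ^+ 2 - 3)
     + y * s * (r0 * s + r1 * w ^+ 3))
  + 2 * y * s ^+ 2 * (w ^+ 2 - 3) * (x * d) ^+ 2.
Proof.
move=> -> e ea.
transitivity (y * (w ^+ 2 - 1) ^+ 3 * x ^+ 2 * (4 * a - 6 * d ^+ 2)
              + 2 * y * (w ^+ 2 - 1) ^+ 2 * x ^+ 2 * d ^+ 2 * (w ^+ 2 - 3)).
  by ring.
rewrite ea.
transitivity ((w ^+ 2 - 1) * x ^+ 2 * (y * q * (4 * (t * (w ^+ 2 - 1)) ^+ 2
    - 27 * (w ^+ 2 - 1) ^+ 2)
  + y * (w ^+ 2 - 1) * (r0 * (w ^+ 2 - 1) + r1 * (t * (w ^+ 2 - 1))))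
  + 2 * y * (w ^+ 2 - 1) ^+ 2 * (w ^+ 2 - 3) * (x * d) ^+ 2); first by ring.
by rewrite -e; ring.
Qed.

Lemma size_q27 : size q27 = 3%N.
Proof.
rewrite q27E -[4](rmorph_nat (@polyC rat)) -[27](rmorph_nat (@polyC rat)) mul_polyC.
rewrite size_polyDl ?size_scale ?size_polyXn // size_polyN.
exact: leq_ltn_trans (size_polyC_leq1 _) _.
Qed.

Lemma q27_neq0 : q27 != 0.
Proof. by rewrite -size_poly_gt0 size_q27. Qed.

Lemma size2_polyP (R : comNzRingType) (p : {poly R}) :
  (size p <= 2)%N -> exists a b, p = a%:P + b%:P * 'X.
Proof.
move=> sp; exists p`_0, p`_1; apply/polyP => i.
rewrite !coefE; case: i => [|[|i]] /=; rewrite ?mulr0 ?addr0 ?mulr1 ?add0r //.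
exact/nth_default/(leq_trans sp).
Qed.

(** Otherwise w^2 - 3 divides the homogenised remainder of 4 A - 6 D^2 modulo 4 t^2 - 27. That
    remainder is then zero, against [q27_ndvd]. *)
Lemma x_sub_theta_coprime_q3 (A B D : {poly rat}) (n : nat) :
  reduced_point A B D -> (size A <= (2 * n).+1)%N -> (size D <= n.+1)%N ->
  coprimep q3 (x_sub_theta n A D).
Proof.
move=> rp sA sD; rewrite irreducible_poly_coprime; last exact: irreducible_q3.
apply/negP => dv; move/negP: (q27_ndvd q27E irreducible_q27 rp); apply.
set P := 4 * A - 6 * D ^+ 2.
have EP : P = P %/ q27 * q27 + P %% q27 by apply: divp_eq.
have sR : (size (P %% q27)%R <= 2)%N by rewrite -ltnS -size_q27 ltn_modp q27_neq0.
have [r0 [r1 Er]] := size2_polyP sR.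
rewrite /dvdp Er; move: EP; rewrite Er; move: (P %/ q27) => Q EP.
have eP : 4 * phi A - 6 * phi D ^+ 2
    = phi Q * (4 * tau ^+ 2 - 27) + (tofrac r0%:P + tofrac r1%:P * tau).
  have := congr1 phi EP; rewrite /P q27E.
  by rewrite !(rmorph_nat, rmorphD, rmorphN, rmorphXn, rmorphM) !phiC phiX.
pose m := size Q; pose r := r0%:P * sw + r1%:P * 'X ^+ 3.
have id : 4 * (sw ^+ m * sw ^+ 2 * x_sub_theta n A D) =
  sw * (sw ^+ n) ^+ 2 * (homog m Q * q3 ^+ 2 * (4 * 'X ^+ 2 - 3) + sw ^+ m * sw * r)
  + 2 * sw ^+ m * sw ^+ 2 * q3 * homog n D ^+ 2.
  have q2 : tofrac sw ^+ (2 * n) = (tofrac sw ^+ n) ^+ 2 :> Qt.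
    by rewrite mulnC exprM.
  apply/eqP; rewrite -tofrac_eq; apply/eqP; rewrite /x_sub_theta /r q3E.
  rewrite !(rmorph_nat, tofracD, tofracN, tofracXn, tofracM) !homogE // q2.
  exact: x_sub_theta_mod_q3 tofrac_sw tau_eq eP.
have cq3s : coprimep q3 sw.
  have -> : sw = 1 * q3 + 2%:P by rewrite q3E swE (rmorph_nat (@polyC rat)); ring.
  by rewrite coprimep_addl_mul -[2%:P]mulr1 mul_polyC coprimepZr // coprimep1.
have dvr : q3 %| r.
  have : q3 %| sw * (sw ^+ n) ^+ 2 *
      (homog m Q * q3 ^+ 2 * (4 * 'X ^+ 2 - 3) + sw ^+ m * sw * r).
    rewrite -(dvdp_addl _ (_ : q3 %| 2 * sw ^+ m * sw ^+ 2 * q3 * homog n D ^+ 2)).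
      by rewrite -id; apply: dvdp_mull; apply: dvdp_mull.
    by rewrite mulrAC; apply: dvdp_mulIr.
  rewrite Gauss_dvdpr; last by rewrite coprimepMr cq3s !coprimep_expr.
  rewrite dvdp_addr; last by rewrite mulrAC; apply: dvdp_mull; apply: dvdp_exp.
  by rewrite Gauss_dvdpr // coprimepMr cq3s coprimep_expr.
(* Modulo w^2 - 3, w^2 - 1 becomes 2 and w^3 becomes 3 w. *)
have : q3 %| (2 * r0)%:P + (3 * r1)%:P * 'X.
  have -> : (2 * r0)%:P + (3 * r1)%:P * 'X = r - (r0%:P + r1%:P * 'X) * q3.
    by rewrite /r q3E swE !polyCM !rmorph_nat; ring.
  by rewrite dvdp_subl // dvdp_mulIr.
set l := _ + _ => dvl.
have l0 : l = 0.
  apply/eqP/negPn/negP => nl; have := dvdp_leq nl dvl; rewrite size_q3 leqNgt ltnS.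
  rewrite /l (leq_trans (size_polyD _ _)) // geq_max.
  rewrite (leq_trans (size_polyC_leq1 _)) //=.
  by rewrite (leq_trans (size_polyMleq _ _)) // size_polyX addn2 /= ltnS size_polyC_leq1.
have := congr1 (horner^~ 1) l0; have := congr1 (horner^~ 0) l0.
rewrite /l !hornerE => /eqP; rewrite mulf_eq0 /= => /eqP-> /eqP.
by rewrite mulr0 add0r mulf_eq0 /= => /eqP->; rewrite mul0r addr0.
Qed.

(** The order at w = 0 is even: it is 0 if A(0) is nonzero. If A(0) = 0, the term in A is divisible
    by w^3 while D(0) is nonzero, so the order is 2. *)
Lemma x_sub_theta_origin (A B D : {poly rat}) (n : nat) :
  reduced_point A B D -> (size A <= (2 * n).+1)%N -> (size D <= n.+1)%N ->
  exists e U, x_sub_theta n A D = ('X ^+ e) ^+ 2 * U /\ ~~ root U 0.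
Proof.
move=> [D0 cAD _] sA sD.
have ev N (p : {poly rat}) : (size p <= N.+1)%N -> (homog N p).[0] = (-1) ^+ N * p.[0].
  move=> sp; have := @homog_eval _ idfun 0 0 N p sp.
  rewrite !map_poly_id // mul0r expr0n => /(_ erefl) ->.
  by rewrite expr0n sub0r.
have [A0|A0] := eqVneq A.[0] 0; last first.
  exists 0%N, (x_sub_theta n A D); split; first by rewrite expr0 expr1n mul1r.
  rewrite rootE /x_sub_theta swE !hornerE /= ev //.
  by rewrite mulf_neq0 // mulf_neq0 // expf_neq0 // oppr_eq0 oner_eq0.
have /factor_theorem[A1 EA] : root A 0 by rewrite rootE A0.
rewrite subr0 in EA.
have sA1 : (size A1 <= (2 * n).+1)%N.
  have [->|nA1] := eqVneq A1 0; first by rewrite size_poly0.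
  by apply: leq_trans sA; rewrite EA size_mulX.
exists 1%N, ('X * homog (2 * n) A1 - homog n D ^+ 2); split.
  rewrite expr1 /x_sub_theta mulrBr; congr (_ - _).
  apply/eqP; rewrite -tofrac_eq !(tofracXn, tofracM) !homogE // EA rmorphM phiX.
  apply/eqP; transitivity (tofrac sw ^+ (2 * n) * phi A1 * (tofrac 'X ^+ 3)); last by ring.
  by rewrite tau_eq -tofrac_sw; ring.
rewrite rootE !hornerE /= ev // oppr_eq0 expf_neq0 //.
rewrite mulf_neq0 ?expf_neq0 ?oppr_eq0 ?oner_eq0 //.
apply/eqP => D00; move: cAD; rewrite coprimep_def => /eqP sg.
have : 'X - 0%:P %| gcdp A D by rewrite dvdp_gcd !dvdp_XsubCl !rootE A0 D00 eqxx.
by move/dvdp_leq; rewrite size_XsubC -size_poly_gt0 sg => /(_ isT).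
Qed.

Lemma odd_even_power (R : comNzRingType) (p : R) (k : nat) :
  exists (b : bool) h, p ^+ k = p ^+ b * (p ^+ h) ^+ 2.
Proof.
by exists (odd k), k./2; rewrite -exprM -exprD muln2 odd_double_half.
Qed.

(* A prime dividing x - theta to an odd power divides the complementary factor of
   (x - theta)(x^2 + theta x + theta^2 - t^2) = y^2 as well, hence divides
   3 theta^2 - t^2 = w^4 (3 - w^2) / (w^2 - 1)^2, so it is w or w^2 - 3. The local
   computations at these two primes rule them out. *)
Lemma x_sub_theta_square_class (A B D : {poly rat}) (n : nat) :
  reduced_point A B D -> B != 0 ->
  (size A <= (2 * n).+1)%N -> (size D <= n.+1)%N -> (size B <= (3 * n).+2)%N ->
  exists c (k l : bool) S,
    sw * x_sub_theta n A D = c *: (('X - 1) ^+ k * ('X + 1) ^+ l * S ^+ 2).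
Proof.
move=> rp nB sA sD sB.
have [e [U [EU U0]]] := x_sub_theta_origin rp sA sD.
have nU : U != 0 by apply: contraNneq U0 => ->; rewrite root0.
(* The powers of w - 1 and w + 1 are split off next; the remaining factor [G] has to be a square up
   to a constant. *)
have [i [U1 /implyP/(_ nU) U11 EU1]] := multiplicity_XsubC U 1.
have nU1 : U1 != 0 by apply: contraNneq U11 => ->; rewrite root0.
have [j [G /implyP/(_ nU1) G1 EG]] := multiplicity_XsubC U1 (-1).
have cG1 : coprimep G ('X - 1%:P).
  by rewrite coprimep_XsubC; apply: contra U11; rewrite EG rootM => ->.
have cGm : coprimep G ('X - (-1)%:P) by rewrite coprimep_XsubC.
have cGX : coprimep G 'X.
  rewrite -['X]subr0 coprimep_XsubC; apply: contra U0.
  by rewrite EU1 EG !rootM => ->.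
have Esw : sw = ('X - 1%:P) * ('X - (-1)%:P) by rewrite swE polyCN polyC1; ring.
have cGs : coprimep G sw by rewrite Esw coprimepMr cG1.
have GU : G %| x_sub_theta n A D 
  by rewrite EU EU1 EG; apply: dvdp_mull; apply: dvdp_mulr; apply: dvdp_mulIl.
have cGq : coprimep G q3.
  by rewrite coprimep_sym (coprimep_dvdl GU) // (x_sub_theta_coprime_q3 rp).
have [_ cAD _] := rp.
have [a [b [k Eab]]] := bezout_homog cAD sA sD.
have modG p q : G %| p - q -> coprimep G q -> coprimep G p.
  move=> /dvdpP[r Er]; have -> : p = r * G + q by rewrite -Er subrK.
  by rewrite coprimep_addl_mul.
(* Modulo G, a common factor with the homogenised D would also divide sw times the homogenised A,
   hence by Bezout a power of [sw]. *)
have cGD : coprimep G (homog n D).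
  have : coprimep G ((a * 'X ^+ 2 * homog n D + b * sw) * homog n D).
    apply: (modG _ (sw ^+ k.+1)); last exact: coprimep_expr.
    rewrite [sw ^+ _]exprS -Eab; have -> : (a * 'X ^+ 2 * homog n D + b * sw) * homog n D
      - sw * (a * homog (2 * n) A + b * homog n D) = - (a * x_sub_theta n A D).
      by rewrite /x_sub_theta; ring.
    by rewrite dvdpNr dvdp_mull.
  by rewrite coprimepMr => /andP[].
pose V := sw * homog (2 * n) A ^+ 2 + 'X ^+ 2 * homog (2 * n) A * homog n D ^+ 2
          - 'X ^+ 4 * homog n D ^+ 4.
have cGV : coprimep G V.
  suff : coprimep G (sw * V) by rewrite coprimepMr => /andP[].
  (* This is 3 theta^2 - t^2, the value of the complementary factor at x = theta, cleared of
     denominators. *)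
  apply: (modG _ (- ('X ^+ 4 * homog n D ^+ 4 * q3))).
    have -> : sw * V - - ('X ^+ 4 * homog n D ^+ 4 * q3)
      = x_sub_theta n A D * (sw * homog (2 * n) A + 2 * 'X ^+ 2 * homog n D ^+ 2).
      by rewrite /V /x_sub_theta q3E swE; ring.
    by rewrite dvdp_mulr.
  rewrite -scaleN1r coprimepZr // coprimepMr cGq andbT coprimepMr.
  by apply/andP; split; apply: coprimep_expr.
have nW : homog (3 * n).+1 B != 0.
  by rewrite -tofrac_eq0 homogE // mulf_neq0 ?phi_eq0 // expf_neq0 // sw_neq0.
have [c [S EGS]] : exists c S, G = c *: S ^+ 2.
  pose M := ('X ^+ e) ^+ 2 * ('X - 1%:P) ^+ i * ('X - (-1)%:P) ^+ j * V.
  apply: (@coprime_mul_sqr _ G M _ nW); last first.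
    by rewrite -(homog_curve rp sA sD sB) -/V -/(x_sub_theta n A D) EU EU1 EG /M; ring.
  by rewrite /M !coprimepMr cGV !coprimep_expr // coprimep_expr.
(* The extra factor [sw] raises both exponents by one. *)
have [k1 [h1 E1]] := odd_even_power ('X - 1%:P : {poly rat}) i.+1.
have [l1 [h2 E2]] := odd_even_power ('X - (-1)%:P : {poly rat}) j.+1.
exists c, k1, l1, ('X ^+ e * ('X - 1%:P) ^+ h1 * ('X - (-1)%:P) ^+ h2 * S).
have -> : 'X + 1 = 'X - (-1)%:P :> {poly rat} by rewrite polyCN polyC1 opprK.
have -> : 'X - 1 = 'X - 1%:P :> {poly rat} by rewrite polyC1.
transitivity (c *: (('X - 1%:P) ^+ i.+1 * ('X - (-1)%:P) ^+ j.+1 * ('X ^+ e * S) ^+ 2)).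
  by rewrite EU EU1 EG EGS Esw !exprS -!mul_polyC; ring.
by rewrite E1 E2 -!mul_polyC; ring.
Qed.

(** * Specialization at t0 *)

Lemma vieta_cubic (t : algC) : exists w1 w2 w3 : algC,
  [/\ w1 + w2 + w3 = t, w1 * w2 + w1 * w3 + w2 * w3 = 0 & w1 * w2 * w3 = - t].
Proof.
pose g : {poly algC} := 'X^3 - t%:P * 'X^2 + t%:P.
have sg : size g = 4%N.
  rewrite /g -addrA size_polyDl ?size_polyXn //.
  apply: leq_ltn_trans (size_polyD _ _) _; rewrite gtn_max size_polyN mul_polyC.
  rewrite (leq_ltn_trans (size_scale_leq _ _)) ?size_polyXn //.
  exact: leq_ltn_trans (size_polyC_leq1 _) _.
have lg : lead_coef g = 1.
  by rewrite lead_coefE sg /g !coefE /= !mulr0 subr0 addr0.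
have [r] := closed_field_poly_normal g; rewrite lg scale1r => Eg.
have sr : size r = 3%N by have := size_prod_XsubC r id; rewrite -Eg sg => -[].
case: r sr Eg => [|w1 [|w2 [|w3 []]]] // _; rewrite !big_cons big_nil mulr1 => Eg.
exists w1, w2, w3.
have ev x : x ^+ 3 - t * x ^+ 2 + t = (x - w1) * ((x - w2) * (x - w3)).
  by have := congr1 (horner^~ x) Eg; rewrite /g !hornerE.
(* The symmetric functions are read off from the values at 0, 1 and -1. *)
have e0 := ev 0; have e1 := ev 1; have e2 := ev (- 1); have e3 := ev 2.
have h3 : w1 * w2 * w3 = - t.
  apply: oppr_inj; transitivity (0 ^+ 3 - t * 0 ^+ 2 + t); last by ring.
  by rewrite e0; ring.
have two : (2 : algC) != 0 by rewrite pnatr_eq0.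
have h1 : w1 + w2 + w3 = t.
  apply: (mulfI two); apply: oppr_inj; apply/eqP; rewrite -subr_eq0; apply/eqP.
  transitivity ((1 - w1) * ((1 - w2) * (1 - w3)) + (- 1 - w1) * ((- 1 - w2) * (- 1 - w3))
    - 2 * ((0 - w1) * ((0 - w2) * (0 - w3))) + 2 * t); first by ring.
  by rewrite -e0 -e1 -e2; ring.
split=> //.
transitivity ((1 - w1) * ((1 - w2) * (1 - w3)) - 1 + (w1 + w2 + w3) + w1 * w2 * w3).
  by ring.
by rewrite -e1 h1 h3; ring.
Qed.

(** The coefficients do not depend on the root w, so the trace and norm of T(w) become rational
    expressions in them. *)
Lemma reduce_mod_cubic (R : comNzRingType) (f : {rmorphism rat -> R}) (t : rat)
    (T : {poly rat}) :
  exists h0 h1 h2 : rat, forall w : R, w ^+ 3 = f t * (w ^+ 2 - 1) ->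
    (map_poly f T).[w] = f h0 + f h1 * w + f h2 * w ^+ 2.
Proof.
elim/poly_ind: T => [|T c [h0 [h1 [h2 IH]]]].
  by exists 0, 0, 0 => w _; rewrite !rmorph0 horner0; ring.
exists (c - h2 * t), h0, (h1 + h2 * t) => w ew.
rewrite rmorphD rmorphM /= map_polyX map_polyC /= hornerD hornerM hornerX hornerC IH //.
rewrite rmorphB rmorphD !rmorphM.
transitivity (f c + f h0 * w + f h1 * w ^+ 2 + f h2 * w ^+ 3); first by ring.
by rewrite ew; ring.
Qed.

Lemma trace_norm_rational (R : comNzRingType) (f : {rmorphism rat -> R})
    (t : rat) (T : {poly rat}) (w1 w2 w3 : R) :
  w1 + w2 + w3 = f t -> w1 * w2 + w1 * w3 + w2 * w3 = 0 -> w1 * w2 * w3 = - f t ->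
  exists a e : rat,
    (map_poly f T).[w1] + (map_poly f T).[w2] + (map_poly f T).[w3] = f a /\
    (map_poly f T).[w1] * (map_poly f T).[w2] * (map_poly f T).[w3] = f e.
Proof.
move=> s1 s2 s3.
have rt w : (w - w1) * (w - w2) * (w - w3) = 0 -> w ^+ 3 = f t * (w ^+ 2 - 1).
  move=> e; apply/eqP; rewrite -subr_eq0; apply/eqP; rewrite -[RHS]e.
  transitivity (w ^+ 3 - (w1 + w2 + w3) * w ^+ 2
    + (w1 * w2 + w1 * w3 + w2 * w3) * w - w1 * w2 * w3); last by ring.
  by rewrite s1 s2 s3; ring.
have [h0 [h1 [h2 H]]] := reduce_mod_cubic f t T.
rewrite !H; [|by apply: rt; rewrite subrr; ring|by apply: rt; rewrite subrr; ring
             |by apply: rt; rewrite subrr; ring].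
(* Trace and norm of h0 + h1 w + h2 w^2 when the elementary symmetric functions of the roots are t,
   0 and -t. *)
exists (3 * h0 + h1 * t + h2 * t ^+ 2).
exists (h0 ^+ 3 + h0 ^+ 2 * h1 * t + h0 ^+ 2 * h2 * t ^+ 2 + 3 * h0 * h1 * h2 * t
  + 2 * h0 * h2 ^+ 2 * t ^+ 2 - h1 ^+ 3 * t - h1 ^+ 2 * h2 * t ^+ 2
  + h2 ^+ 3 * t ^+ 2).
rewrite !(rmorph_nat, rmorphD, rmorphN, rmorphXn, rmorphM) -/(f t).
move: (f h0) (f h1) (f h2) => x y z; split.
  transitivity (3 * x + y * (w1 + w2 + w3) + z * ((w1 + w2 + w3) ^+ 2
     - 2 * (w1 * w2 + w1 * w3 + w2 * w3))); first by ring.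
  by rewrite s1 s2; ring.
pose e1 := w1 + w2 + w3; pose e2 := w1 * w2 + w1 * w3 + w2 * w3.
pose e3 := w1 * w2 * w3.
transitivity (x ^+ 3 + x ^+ 2 * y * e1 + x ^+ 2 * z * (e1 ^+ 2 - 2 * e2)
  + x * y ^+ 2 * e2 + x * y * z * (e1 * e2 - 3 * e3)
  + x * z ^+ 2 * (e2 ^+ 2 - 2 * e1 * e3) + y ^+ 3 * e3 + y ^+ 2 * z * e1 * e3
  + y * z ^+ 2 * e2 * e3 + z ^+ 3 * e3 ^+ 2).
  by rewrite /e1 /e2 /e3; ring.
by rewrite /e1 /e2 /e3 s1 s2 s3; ring.
Qed.

(** Let z, s and e be the elementary symmetric functions of the b's. Then z^2 = m1 + 2 s and s^2 =
    m2 + 2 e z; eliminating s gives the quartic. It is monic over the integers, so the rational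
    number z is an integer. *)
Lemma square_root_trace (b1 b2 b3 : algC) (a e : rat) (m1 m2 : int) :
  b1 + b2 + b3 = ratr a -> b1 * b2 * b3 = ratr e -> (b1 * b2 * b3) ^+ 2 = 1 ->
  b1 ^+ 2 + b2 ^+ 2 + b3 ^+ 2 = m1%:~R ->
  b1 ^+ 2 * b2 ^+ 2 + b1 ^+ 2 * b3 ^+ 2 + b2 ^+ 2 * b3 ^+ 2 = m2%:~R ->
  exists z k : int, k ^+ 2 = 1 /\ (z ^+ 2 - m1) ^+ 2 = 8 * k * z + 4 * m2.
Proof.
move=> sa se e2 s1 s2.
have {}e2 : e ^+ 2 = 1.
  apply: (fmorph_inj (ratr : {rmorphism rat -> algC})).
  by rewrite rmorphXn rmorph1 /= -se.
have [k [ek k2]] : exists k : int, e = k%:~R /\ k ^+ 2 = 1.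
  by move/eqP: e2; rewrite sqrf_eq1 => /orP[]/eqP->; [exists 1|exists (-1)].
have E : (a ^+ 2 - m1%:~R) ^+ 2 = 8 * k%:~R * a + 4 * m2%:~R.
  apply: (fmorph_inj (ratr : {rmorphism rat -> algC})).
  rewrite !(rmorph_nat, rmorphD, rmorphN, rmorphXn, rmorphM) /= !ratr_int.
  rewrite -s1 -s2 -sa -(ratr_int _ k) -ek -se; ring.
have [|z az Ez] := @monic_quartic_int_root a (- 2 * m1) (- 8 * k) (m1 ^+ 2 - 4 * m2).
  rewrite !(rmorphD, rmorphN, rmorphXn, rmorphM) /=.
  transitivity ((a ^+ 2 - m1%:~R) ^+ 2 - (8 * k%:~R * a + 4 * m2%:~R)); first by ring.
  by rewrite E subrr.
exists z, k; split=> //; apply/eqP; rewrite -subr_eq0; apply/eqP.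
by rewrite -[RHS]Ez; ring.
Qed.

Definition evalC (w : algC) : {rmorphism {poly rat} -> algC} :=
  horner_eval w \o map_poly ratr.

Lemma evalC_homog (t : rat) (w : algC) (N : nat) (p : {poly rat}) :
  (size p <= N.+1)%N -> w ^+ 3 = ratr t * (w ^+ 2 - 1) ->
  evalC w (homog N p) = (w ^+ 2 - 1) ^+ N * ratr p.[t].
Proof.
by move=> sp ew; rewrite /evalC /= /horner_eval (homog_eval _ sp ew) horner_map.
Qed.

Lemma evalCX w : evalC w 'X = w.
Proof. by rewrite /evalC /= map_polyX /horner_eval hornerX. Qed.

Lemma evalCC w c : evalC w c%:P = ratr c.
Proof. by rewrite /evalC /= map_polyC /horner_eval hornerC. Qed.

(* At a point reducing to O, specializing w to a root of w^3 = t0 (w^2 - 1) turns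
   x - theta into a rational square, so a square class (w - 1)^k (w + 1)^l would make
   the corresponding unit of the cubic field a square up to a rational factor, and the
   norm fixes that factor. *)
Lemma x_sub_theta_square (t0 : nat) (A B D : {poly rat}) (n : nat) :
  (1 < t0)%N -> (t0 %% 4 = 1)%N -> reduced_point A B D -> D.[t0%:R] = 0 ->
  (size A <= (2 * n).+1)%N -> (size D <= n.+1)%N -> (size B <= (3 * n).+2)%N ->
  exists S, sw * x_sub_theta n A D = S ^+ 2.
Proof.
move=> t01 t04 rp D0 sA sD sB.
have [nD cAD EB] := rp.
set t : rat := t0%:R.
have At : A.[t] != 0.
  apply/eqP => A0; move: cAD; rewrite coprimep_def => /eqP sg.
  have : 'X - t%:P %| gcdp A D by rewrite dvdp_gcd !dvdp_XsubCl !rootE A0 D0 eqxx.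
  by move/dvdp_leq; rewrite size_XsubC -size_poly_gt0 sg => /(_ isT).
have EBt : B.[t] ^+ 2 = A.[t] ^+ 3.
  have := congr1 (horner^~ t) EB; rewrite !(hornerD, hornerN, horner_exp, hornerM) D0.
  by rewrite !expr0n !mulr0 subr0 addr0.
have Bt : B.[t] != 0.
  apply: contra_neq At => b0; apply/eqP; move/esym/eqP: EBt.
  by rewrite b0 expr0n expf_eq0.
(* With D(t0) = 0 the curve equation becomes B^2 = A^3 at t0, so A(t0) = (B(t0)/A(t0))^2. *)
have [a [na Ea]] : exists a, a != 0 /\ A.[t] = a ^+ 2.
  exists (B.[t] / A.[t]); split; first by rewrite mulf_neq0 ?invr_eq0.
  by rewrite expr_div_n EBt; field.
have nB : B != 0 by apply: contra_neq Bt => ->; rewrite horner0.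
have [c [k [l [S E]]]] := x_sub_theta_square_class rp nB sA sD sB.
have [w1 [w2 [w3 [s1 s2 s3]]]] := vieta_cubic (ratr t).
have rt w : (w - w1) * (w - w2) * (w - w3) = 0 -> w ^+ 3 = ratr t * (w ^+ 2 - 1).
  move=> e; apply/eqP; rewrite -subr_eq0; apply/eqP; rewrite -[RHS]e.
  transitivity (w ^+ 3 - (w1 + w2 + w3) * w ^+ 2
    + (w1 * w2 + w1 * w3 + w2 * w3) * w - w1 * w2 * w3); last by ring.
  by rewrite s1 s2 s3; ring.
have r1 : w1 ^+ 3 = ratr t * (w1 ^+ 2 - 1) by apply: rt; rewrite subrr; ring.
have r2 : w2 ^+ 3 = ratr t * (w2 ^+ 2 - 1) by apply: rt; rewrite subrr; ring.
have r3 : w3 ^+ 3 = ratr t * (w3 ^+ 2 - 1) by apply: rt; rewrite subrr; ring.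
have [u Eu] : exists u : {poly rat}, u = ('X - 1) ^+ k * ('X + 1) ^+ l by eexists.
(* At a root w, t w - w^2 - 1 inverts w^2 - 1; thus T(w) = u S / (w^2 - 1)^(n+1) and c T(w)^2 = u(w)
   a^2. *)
have [T defT] : exists T, T = u * S * (t%:P * 'X - 'X ^+ 2 - 1) ^+ n.+1 by eexists.
rewrite -Eu in E.
have evu w : evalC w u = (w - 1) ^+ k * (w + 1) ^+ l.
  by rewrite Eu !(rmorphM, rmorphXn, rmorphB, rmorphD) !rmorph1 evalCX.
have ET w : w ^+ 3 = ratr t * (w ^+ 2 - 1) ->
    ratr c * evalC w T ^+ 2 = evalC w u * ratr a ^+ 2.
  move=> ew.
  have := congr1 (evalC w) E; rewrite /x_sub_theta -mul_polyC.
  rewrite !(rmorphN, rmorphD, rmorphXn, rmorphM) !(evalC_homog _ ew) // D0 evalCX evalCC.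
  have -> : evalC w sw = w ^+ 2 - 1 by rewrite swE rmorphB rmorphXn rmorph1 evalCX.
  rewrite Ea rmorph0 rmorphXn !mulr0 expr0n mulr0 subr0 => EE.
  have inv : (w ^+ 2 - 1) * (ratr t * w - w ^+ 2 - 1) = 1.
    transitivity (ratr t * (w ^+ 2 - 1) * w - (w ^+ 2 - 1) * (w ^+ 2 + 1)).
      by ring.
    by rewrite -ew; ring.
  have invn : (w ^+ 2 - 1) ^+ n.+1 * (ratr t * w - w ^+ 2 - 1) ^+ n.+1 = 1.
    by rewrite -exprMn inv expr1n.
  have -> : evalC w T = evalC w u * evalC w S * (ratr t * w - w ^+ 2 - 1) ^+ n.+1.
    by rewrite defT !(rmorphB, rmorphXn, rmorphM) rmorph1 evalCX evalCC.
  transitivity (evalC w u * (ratr c * (evalC w u * evalC w S ^+ 2))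
     * (ratr t * w - w ^+ 2 - 1) ^+ n.+1 ^+ 2).
    by move: (_ ^+ n.+1) => x; ring.
  rewrite -EE; transitivity (evalC w u * ratr a ^+ 2 *
     ((w ^+ 2 - 1) ^+ n.+1 * (ratr t * w - w ^+ 2 - 1) ^+ n.+1) ^+ 2).
    rewrite mul2n -addnn exprD [(w ^+ 2 - 1) ^+ n.+1]exprS.
    by move: ((w ^+ 2 - 1) ^+ n) (_ ^+ n.+1) => x y; ring.
  by rewrite invn expr1n mulr1.
have pu1 : (w1 - 1) * (w2 - 1) * (w3 - 1) = - 1.
  transitivity (w1 * w2 * w3 - (w1 * w2 + w1 * w3 + w2 * w3) + (w1 + w2 + w3) - 1).
    by ring.
  by rewrite s1 s2 s3; ring.
have pu2 : (w1 + 1) * (w2 + 1) * (w3 + 1) = 1.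
  transitivity (w1 * w2 * w3 + (w1 * w2 + w1 * w3 + w2 * w3) + (w1 + w2 + w3) + 1).
    by ring.
  by rewrite s1 s2 s3; ring.
have pu : evalC w1 u * evalC w2 u * evalC w3 u = (-1) ^+ k.
  rewrite !evu.
  transitivity (((w1 - 1) * (w2 - 1) * (w3 - 1)) ^+ k
                * ((w1 + 1) * (w2 + 1) * (w3 + 1)) ^+ l).
    by rewrite !exprMn; ring.
  by rewrite pu1 pu2 expr1n mulr1.
have [tr [nu [Etr Enu]]] := trace_norm_rational (f := ratr) T s1 s2 s3.
rewrite -[_.[w1]]/(evalC w1 T) -[_.[w2]]/(evalC w2 T) -[_.[w3]]/(evalC w3 T) in Etr Enu.
(* Taking norms over the three roots determines c modulo squares: it is (-1)^k times a square. *)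
have Ec : c ^+ 3 * nu ^+ 2 = (-1) ^+ k * a ^+ 6.
  apply: (fmorph_inj (ratr : {rmorphism rat -> algC})).
  rewrite !(rmorphM, rmorphXn, rmorphN) rmorph1 -[X in _ * X ^+ 2]Enu -pu.
  transitivity ((ratr c * evalC w1 T ^+ 2) * (ratr c * evalC w2 T ^+ 2)
                * (ratr c * evalC w3 T ^+ 2)); first by ring.
  by rewrite !ET //; ring.
have c0 : c != 0.
  apply/eqP => c0; have /eqP := Ec; rewrite c0 expr0n mul0r eq_sym mulf_eq0.
  by rewrite !expf_eq0 oppr_eq0 oner_eq0 (negbTE na) andbF.
have nu0 : nu != 0.
  apply/eqP => nu0; have /eqP := Ec; rewrite nu0 expr0n mulr0 eq_sym mulf_eq0.
  by rewrite !expf_eq0 oppr_eq0 oner_eq0 (negbTE na) andbF.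
have [rho Erho] : exists rho, c = (-1) ^+ k * rho ^+ 2.
  exists (a ^+ 3 / (c * nu)); rewrite expr_div_n -exprM mulrA -[(3 * 2)%N]/6%N -Ec.
  by field; rewrite c0 nu0.
case: (boolP (k || l)) => [kl|]; last first.
  rewrite negb_or => /andP[/negbTE k0 /negbTE l0].
  exists (rho *: S); rewrite E Eu k0 l0 !expr0 !mul1r Erho k0 expr0 mul1r.
  by rewrite exprZn.
exfalso.
(* (rho / a) T(w) is a square root of the unit (1 - w)^k (1 + w)^l. *)
have Eb w : w ^+ 3 = ratr t * (w ^+ 2 - 1) ->
    (ratr (rho / a) * evalC w T) ^+ 2 = (-1) ^+ k * evalC w u.
  move=> /ET ew; apply: (mulfI (_ : ratr c != 0 :> algC)); first by rewrite fmorph_eq0.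
  have na' : ratr a != 0 :> algC by rewrite fmorph_eq0.
  rewrite fmorph_div; transitivity ((ratr rho / ratr a) ^+ 2 * (ratr c * evalC w T ^+ 2)).
    by move: (ratr rho / ratr a) => x; ring.
  rewrite ew {1}Erho !(rmorphM, rmorphXn, rmorphN) rmorph1.
  transitivity (((-1) ^+ k) ^+ 2 * (ratr rho ^+ 2 * evalC w u) : algC).
    by rewrite sqrr_sign mul1r; field.
  by move: ((-1) ^+ k : algC) => x; ring.
set b := fun w => ratr (rho / a) * evalC w T in Eb.
have sb : b w1 + b w2 + b w3 = ratr (rho / a * tr).
  by rewrite rmorphM /= -Etr /b !mulrDr.
have pb : b w1 * b w2 * b w3 = ratr ((rho / a) ^+ 3 * nu).
  by rewrite rmorphM rmorphXn /= -Enu /b; move: (ratr (rho / a)) => x; ring.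
have pb2 : (b w1 * b w2 * b w3) ^+ 2 = 1.
  transitivity (b w1 ^+ 2 * b w2 ^+ 2 * b w3 ^+ 2); first by ring.
  rewrite !Eb //.
  transitivity (((-1) ^+ k) ^+ 2 * ((-1) ^+ k * (evalC w1 u * evalC w2 u * evalC w3 u)) : algC).
    by move: ((-1) ^+ k : algC) => x; ring.
  by rewrite pu -expr2 !sqrr_sign mulr1.
have contra m1 m2 := @square_root_trace _ _ _ _ _ m1 m2 sb pb pb2.
have et : ratr t = (t0%:Z)%:~R :> algC by rewrite /t ratr_nat.
have tz5 : 5%:Z <= t0%:Z by clear -t01 t04; lia.
have tz4 : (4 %| t0%:Z - 1)%Z by clear -t04; lia.
have p2 : w1 ^+ 2 + w2 ^+ 2 + w3 ^+ 2 = ratr t ^+ 2.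
  transitivity ((w1 + w2 + w3) ^+ 2 - 2 * (w1 * w2 + w1 * w3 + w2 * w3)).
    by ring.
  by rewrite s1 s2; ring.
have q2 : w1 ^+ 2 * w2 ^+ 2 + w1 ^+ 2 * w3 ^+ 2 + w2 ^+ 2 * w3 ^+ 2 = 2 * ratr t ^+ 2.
  transitivity ((w1 * w2 + w1 * w3 + w2 * w3) ^+ 2 - 2 * (w1 * w2 * w3) * (w1 + w2 + w3)).
    by ring.
  by rewrite s1 s2 s3; ring.
(* The remaining units are 1 - w^2, 1 - w and 1 + w, in this order; [m1] and [m2] are their first
   two elementary symmetric functions. *)
move: contra; rewrite !Eb // !evu; case: k l kl {E Eu evu Ec Erho pu Eb pb2} => [] [] // _.
- rewrite !expr1 => /(_ (3 - t0%:Z ^+ 2) 3)[||z [e [e2]]].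
  + transitivity (3 - (w1 ^+ 2 + w2 ^+ 2 + w3 ^+ 2)); first by ring.
    by rewrite p2 et rmorphB rmorphXn.
  + transitivity (3 - 2 * (w1 ^+ 2 + w2 ^+ 2 + w3 ^+ 2)
      + (w1 ^+ 2 * w2 ^+ 2 + w1 ^+ 2 * w3 ^+ 2 + w2 ^+ 2 * w3 ^+ 2)); first by ring.
    by rewrite p2 q2; ring.
  + by move/eqP; apply/negP; apply: quartic_1subw2.
- rewrite !expr1 !expr0 => /(_ (3 - t0%:Z) (3 - 2 * t0%:Z))[||z [e [e2]]].
  + transitivity (3 - (w1 + w2 + w3)); first by ring.
    by rewrite s1 et rmorphB.
  + transitivity (3 - 2 * (w1 + w2 + w3) + (w1 * w2 + w1 * w3 + w2 * w3)).
      by ring.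
    by rewrite s1 s2 et addr0 rmorphB rmorphM.
  + by move/eqP; apply/negP; apply: quartic_1subw.
- rewrite !expr1 !expr0 => /(_ (3 + t0%:Z) (3 + 2 * t0%:Z))[||z [e [e2]]].
  + transitivity (3 + (w1 + w2 + w3)); first by ring.
    by rewrite s1 et rmorphD.
  + transitivity (3 + 2 * (w1 + w2 + w3) + (w1 * w2 + w1 * w3 + w2 * w3)).
      by ring.
    by rewrite s1 s2 et addr0 rmorphD rmorphM.
  + by move/eqP; apply/negP; apply: quartic_1addw.
Qed.

(** * Halving and descent *)

(** The ring Q[t][w] inside Q(w), as the Q[t]-module spanned by 1, w and w^2; it is stable under w
    because w^3 = t w^2 - t. *)
Definition Qt_span (z : Qt) : Prop := exists v0 v1 v2 : {poly rat},
  z = phi v0 + phi v1 * tofrac 'X + phi v2 * tofrac 'X ^+ 2.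

Lemma Qt_spanD y z : Qt_span y -> Qt_span z -> Qt_span (y + z).
Proof.
move=> [u0 [u1 [u2 ->]]] [v0 [v1 [v2 ->]]]; exists (u0 + v0), (u1 + v1), (u2 + v2).
by rewrite !rmorphD; ring.
Qed.

Lemma Qt_span_phiM p z : Qt_span z -> Qt_span (phi p * z).
Proof.
move=> [v0 [v1 [v2 ->]]]; exists (p * v0), (p * v1), (p * v2).
by rewrite !rmorphM; ring.
Qed.

Lemma Qt_span_XM z : Qt_span z -> Qt_span (tofrac 'X * z).
Proof.
move=> [v0 [v1 [v2 ->]]]; exists (- ('X * v2)), v0, (v1 + 'X * v2).
rewrite rmorphD rmorphN !rmorphM phiX.
transitivity (phi v0 * tofrac 'X + phi v1 * tofrac 'X ^+ 2 + phi v2 * tofrac 'X ^+ 3).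
  by ring.
by rewrite tau_eq; ring.
Qed.

Lemma Qt_span_poly p : Qt_span (tofrac p).
Proof.
elim/poly_ind: p => [|p c IH].
  by exists 0, 0, 0; rewrite tofrac0 rmorph0; ring.
rewrite tofracD tofracM mulrC; apply: Qt_spanD; first exact: Qt_span_XM.
by exists c%:P, 0, 0; rewrite rmorph0 phiC; ring.
Qed.

(** So w^2 - 1 is a unit of Q[t][w], and its powers can be cleared without leaving the span. *)
Lemma tofrac_sw_inv : tofrac sw * (tau * tofrac 'X - tofrac 'X ^+ 2 - 1) = 1.
Proof.
rewrite tofrac_sw; transitivity
  (tau * (tofrac 'X ^+ 2 - 1) * tofrac 'X - (tofrac 'X ^+ 2 - 1) * (tofrac 'X ^+ 2 + 1)).
  by ring.
by rewrite -tau_eq; ring.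
Qed.

Lemma square_identity (R : comNzRingType) (w t a b c : R) :
  w ^+ 3 = t * (w ^+ 2 - 1) ->
  (a + b * w + c * w ^+ 2) ^+ 2 = (a ^+ 2 - 2 * t * b * c - t ^+ 2 * c ^+ 2)
    + (2 * a * b - t * c ^+ 2) * w + ((b + t * c) ^+ 2 + 2 * a * c) * w ^+ 2.
Proof.
move=> e; transitivity (a ^+ 2 + 2 * a * b * w + (b ^+ 2 + 2 * a * c) * w ^+ 2
    + w ^+ 3 * (2 * b * c + c ^+ 2 * w)); first by ring.
rewrite e; transitivity (a ^+ 2 + 2 * a * b * w + (b ^+ 2 + 2 * a * c) * w ^+ 2
    + 2 * b * c * (t * (w ^+ 2 - 1)) + t * c ^+ 2 * (w ^+ 3 - w)); first by ring.
by rewrite e; ring.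
Qed.

(** From 1/(w^2 - 1) = t w - w^2 - 1 one gets theta = t w - w^2. Here [x] stands for (w^2 - 1)^n and
    [y] for the inverse of (w^2 - 1)^(n+1). *)
Lemma clear_sw_powers (R : comNzRingType) (s w t x y a d : R) :
  s = w ^+ 2 - 1 -> s * (t * w - w ^+ 2 - 1) = 1 -> s * x * y = 1 ->
  y ^+ 2 * (s * (s * (x ^+ 2 * a) - w ^+ 2 * (x * d) ^+ 2))
  = a - (t * w - w ^+ 2) * d ^+ 2.
Proof.
move=> es sj sxy; pose j := t * w - w ^+ 2 - 1; rewrite -/j in sj.
transitivity ((s * x * y) ^+ 2 * a - w ^+ 2 * d ^+ 2 * (1 * (s * x ^+ 2 * y ^+ 2))).
  by ring.
rewrite -sj; transitivity ((s * x * y) ^+ 2 * (a - (s + 1) * j * d ^+ 2)).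
  by rewrite es; ring.
by rewrite sxy mulrDl sj /j; ring.
Qed.

(** A - theta D^2 has a square root v0 + v1 w + v2 w^2 in Q[t][w]; the equations compare the
    coefficients of 1, w and w^2. *)
Lemma sqrt_x_sub_theta (A D S : {poly rat}) (n : nat) :
  (size A <= (2 * n).+1)%N -> (size D <= n.+1)%N -> sw * x_sub_theta n A D = S ^+ 2 ->
  exists v0 v1 v2 : {poly rat},
    [/\ A = v0 ^+ 2 - 2 * 'X * v1 * v2 - 'X ^+ 2 * v2 ^+ 2,
        - 'X * D ^+ 2 = 2 * v0 * v1 - 'X * v2 ^+ 2
      & D ^+ 2 = (v1 + 'X * v2) ^+ 2 + 2 * v0 * v2].
Proof.
move=> sA sD E.
pose iota := tau * tofrac 'X - tofrac 'X ^+ 2 - 1.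
have [v0 [v1 [v2 EG]]] : Qt_span (iota ^+ n.+1 * tofrac S).
  elim: n.+1 => [|k IH]; first by rewrite expr0 mul1r; apply: Qt_span_poly.
  rewrite exprS -mulrA; move: (_ * tofrac S) IH => z IH.
  have -> : iota * z = phi 'X * (tofrac 'X * z)
      + (phi (- 1) * (tofrac 'X * (tofrac 'X * z)) + phi (- 1) * z).
    by rewrite /iota rmorphN rmorph1 phiX; ring.
  by do !(apply: Qt_spanD || apply: Qt_span_phiM || apply: Qt_span_XM).
have iotan : tofrac sw ^+ n.+1 * iota ^+ n.+1 = 1.
  by rewrite -exprMn tofrac_sw_inv expr1n.
have {}E : phi A - (tau * tofrac 'X - tofrac 'X ^+ 2) * phi D ^+ 2
    = (iota ^+ n.+1 * tofrac S) ^+ 2.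
  have := congr1 (fun p : {poly rat} => tofrac p : Qt) E.
  rewrite /x_sub_theta !(tofracD, tofracN, tofracXn, tofracM) !homogE // => E'.
  rewrite exprMn -E' mulnC exprM.
  by rewrite (clear_sw_powers _ _ tofrac_sw tofrac_sw_inv) // -exprS.
exists v0, v1, v2.
move/eqP: E; rewrite EG (square_identity _ _ _ tau_eq) -subr_eq0 => /eqP E.
have [] := @phi_lin_indep (A - (v0 ^+ 2 - 2 * 'X * v1 * v2 - 'X ^+ 2 * v2 ^+ 2))
  (- 'X * D ^+ 2 - (2 * v0 * v1 - 'X * v2 ^+ 2))
  (D ^+ 2 - ((v1 + 'X * v2) ^+ 2 + 2 * v0 * v2)).
  rewrite -[RHS]E !(rmorph_nat, rmorphD, rmorphN, rmorphXn, rmorphM) !phiX.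
  by ring.
by move=> /eqP; rewrite subr_eq0 => /eqP-> /eqP; rewrite subr_eq0 => /eqP-> /eqP;
   rewrite subr_eq0 => /eqP->.
Qed.

(** The half point is (t v2 / e, t d / e). Eliminating v0 through 2 v0 e = t (v2^2 - e^2) yields its
    curve equation and the duplication formula, both cleared of denominators. *)
Lemma halved_identities (R : idomainType) (t v0 v1 v2 d a : R) (e := v1 + t * v2) :
  a = v0 ^+ 2 - 2 * t * v1 * v2 - t ^+ 2 * v2 ^+ 2 ->
  - t * d ^+ 2 = 2 * v0 * v1 - t * v2 ^+ 2 ->
  d ^+ 2 = e ^+ 2 + 2 * v0 * v2 ->
  [/\ e * d ^+ 2 = e ^+ 3 + t * v2 * (v2 ^+ 2 - e ^+ 2),
      4 * e ^+ 2 * a = t ^+ 2 * (v2 ^+ 2 + e ^+ 2) ^+ 2 - 8 * t * e ^+ 3 * v2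
    & t != 0 -> d != 0 -> e != 0].
Proof.
move=> Ea Ed1 Ed2.
have Ev : 2 * v0 * e = t * (v2 ^+ 2 - e ^+ 2).
  apply/eqP; rewrite -subr_eq0; apply/eqP.
  transitivity (t * (e ^+ 2 + 2 * v0 * v2) + (2 * v0 * v1 - t * v2 ^+ 2)).
    by rewrite /e; ring.
  by rewrite -Ed1 -Ed2; ring.
split.
- transitivity (e ^+ 3 + v2 * (2 * v0 * e)); first by rewrite Ed2; ring.
  by rewrite Ev; ring.
- have -> : a = v0 ^+ 2 - 2 * t * (e - t * v2) * v2 - t ^+ 2 * v2 ^+ 2.
    by rewrite Ea /e; ring.
  transitivity ((2 * v0 * e) ^+ 2 - 4 * e ^+ 2 * (2 * t * e * v2 - t ^+ 2 * v2 ^+ 2)).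
    by ring.
  by rewrite Ev; ring.
- move=> t0; apply: contra_neq => e0.
  have v20 : v2 = 0.
    move: Ev; rewrite e0 expr0n mulr0 subr0 => /esym/eqP.
    by rewrite mulf_eq0 (negbTE t0) expf_eq0 => /eqP.
  have : d ^+ 2 == 0 by rewrite Ed2 e0 v20 mulr0 addr0 expr0n.
  by rewrite expf_eq0 => /eqP.
Qed.

Lemma halved_double (F : fieldType) (t v2 e d a a' b' d' : F) :
  e != 0 -> d' != 0 -> 4 * e ^+ 2 * a = t ^+ 2 * (v2 ^+ 2 + e ^+ 2) ^+ 2 - 8 * t * e ^+ 3 * v2 ->
  t * v2 / e = a' / d' ^+ 2 -> t * d / e = b' / d' ^+ 3 ->
  4 * a * d' ^+ 2 * b' ^+ 2 =
  d ^+ 2 * ((a' ^+ 2 + (t * d' ^+ 2) ^+ 2) ^+ 2 - 8 * t ^+ 2 * a' * d' ^+ 6).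
Proof.
move=> e0 d0 E Ea Eb.
have -> : a' = t * v2 / e * d' ^+ 2 by rewrite Ea; field.
have -> : b' = t * d / e * d' ^+ 3 by rewrite Eb; field.
transitivity (4 * e ^+ 2 * a * (t ^+ 2 * d ^+ 2 * d' ^+ 8 / e ^+ 4)); first by field.
by rewrite E; field.
Qed.

Lemma halved_on_curve (F : fieldType) (t v2 e d : F) :
  e != 0 -> e * d ^+ 2 = e ^+ 3 + t * v2 * (v2 ^+ 2 - e ^+ 2) ->
  (t * d / e) ^+ 2 = (t * v2 / e) ^+ 3 + - t ^+ 2 * (t * v2 / e) + t ^+ 2.
Proof.
move=> e0 E; transitivity (t ^+ 2 * (e * d ^+ 2) / e ^+ 3); first by field.
by rewrite E; field.
Qed.

(** Let Q be the half point. If [D'] did not vanish at t0, then D = D' E would force E(t0) = 0; as E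
    divides B', Q would reduce to an affine point with y = 0, giving a rational root of the
    cubic. *)
Lemma kernel_halving (t0 : nat) (A B D : {poly rat}) :
  (1 < t0)%N -> (t0 %% 4 = 1)%N -> reduced_point A B D -> D.[t0%:R] = 0 ->
  exists A' B' D',
    [/\ reduced_point A' B' D', B' != 0, is_double A D A' B' D' & D'.[t0%:R] = 0].
Proof.
move=> t01 t04 rp Dt.
have [nD _ _] := rp.
have [n [sA sD sB]] : exists n, [/\ size A <= (2 * n).+1, size D <= n.+1
                                  & size B <= (3 * n).+2]%N.
  by exists (size A + size B + size D)%N; split; clear; lia.
have [S ES] := x_sub_theta_square t01 t04 rp Dt sA sD sB.
have [v0 [v1 [v2 [E1 E2 E3]]]] := sqrt_x_sub_theta sA sD ES.
have [I1 I2 ne] := halved_identities E1 E2 E3.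
have {}ne := ne (negbT (polyX_eq0 _)) nD.
move: (v1 + 'X * v2) E3 I1 I2 ne => e E3 I1 I2 ne.
have tf (r : {poly rat}) : r != 0 -> (tofrac r : Qt) != 0 by rewrite tofrac_eq0.
have on : E_Qt (Some (tQ * tofrac v2 / tofrac e, tQ * tofrac D / tofrac e)).
  apply: halved_on_curve (tf _ ne) _.
  have := congr1 (fun p : {poly rat} => tofrac p : Qt) I1.
  by rewrite !(tofracD, tofracN, tofracXn, tofracM).
have [A' [B' [D' [rp' EA EB]]]] := reduced_pointP on.
have [nD' _ _] := rp'.
have dbl : is_double A D A' B' D'.
  have := congr1 (fun p : {poly rat} => tofrac p : Qt) I2.
  rewrite !(rmorph_nat, tofracD, tofracN, tofracXn, tofracM) => I2'.
  have := halved_double (tf _ ne) (tf _ nD') I2' EA EB.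
  rewrite /is_double /double_num => H; apply/eqP; rewrite -tofrac_eq; apply/eqP.
  by rewrite !(rmorph_nat, tofracD, tofracN, tofracXn, tofracM).
have nB' : B' != 0.
  apply/eqP => B0; move: EB; rewrite B0 tofrac0 mul0r => /eqP.
  by rewrite !mulf_eq0 invr_eq0 !tofrac_eq0 polyX_eq0 (negbTE nD) (negbTE ne).
exists A', B', D'; split=> //.
have [E [ED EB' _]] := is_double_dvd rp rp' dbl.
move: Dt; rewrite ED hornerM => /eqP; rewrite mulf_eq0 => /orP[/eqP//|Et].
apply/eqP/negPn/negP => D't.
have ot : odd t0 by clear -t04; lia.
have [_ _ EE] := rp'.
have B't : B'.[t0%:R] = 0.
  by have /dvdpP[q ->] := EB'; rewrite hornerM (eqP Et) mulr0.
have := cubic_no_rational_root (A'.[t0%:R] / D'.[t0%:R] ^+ 2) ot.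
have := congr1 (horner^~ t0%:R) EE.
rewrite !(hornerD, hornerN, horner_exp, hornerM) B't hornerX => H.
move/eqP; apply; apply: (mulIf (expf_neq0 6 D't)); rewrite mul0r.
rewrite expr0n /= in H; rewrite [RHS]H.
by field.
Qed.

Lemma no_kernel (t0 : nat) (A B D : {poly rat}) :
  (1 < t0)%N -> (t0 %% 4 = 1)%N -> reduced_point A B D -> D.[t0%:R] != 0.
Proof.
move=> t01 t04; have [m] := ubnP (size D).
elim: m A B D => // m IH A B D sD rp; apply/eqP => Dt.
have [A1 [B1 [D1 [rp1 nB1 d1 D1t]]]] := kernel_halving t01 t04 rp Dt.
have [A2 [B2 [D2 [rp2 nB2 d2 D2t]]]] := kernel_halving t01 t04 rp1 D1t.
have [nD2 _ _] := rp2.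
have sD2 : (1 < size D2)%N by apply: root_size_gt1 nD2 _; apply/eqP; exact: D2t.
have lt := double_size_denominator rp rp1 rp2 d1 d2 nB1 nB2 sD2.
by move: (IH A2 B2 D2 (leq_trans lt sD) rp2); rewrite D2t eqxx.
Qed.

(** * Triviality of the kernel and injectivity *)

Lemma kernel_trivial (t0 : nat) (x y : Qt) :
  (1 < t0)%N -> (t0 %% 4 = 1)%N -> E_Qt (Some (x, y)) -> regular_at t0%:R x.
Proof.
move=> t01 t04 /reduced_pointP[A [B [D [rp -> _]]]].
exists (A.[t0%:R] / (D ^+ 2).[t0%:R]), A, (D ^+ 2).
by rewrite horner_exp expf_neq0 ?(no_kernel t01 t04 rp) // tofracXn.
Qed.

(* The chord through P1 and - P2, whose third point is P2 - P1. *)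
Lemma chord_on_curve (F : fieldType) (a b x1 y1 x2 y2 : F)
    (l := (y1 + y2) / (x1 - x2)) (x3 := l ^+ 2 - x1 - x2) :
  x1 != x2 -> on_curve a b (Some (x1, y1)) -> on_curve a b (Some (x2, y2)) ->
  on_curve a b (Some (x3, l * (x1 - x3) - y1)).
Proof.
rewrite /on_curve => nx E1 E2; have d0 : x1 - x2 != 0 by rewrite subr_eq0.
have ly : y2 = l * (x1 - x2) - y1 by rewrite /l; field.
move: l ly @x3 => l ly x3; rewrite ly in E2.
have El : l ^+ 2 * (x1 - x2) - 2 * l * y1 = - (x1 ^+ 2 + x1 * x2 + x2 ^+ 2 + a).
  apply: (mulIf d0); transitivity ((l * (x1 - x2) - y1) ^+ 2 - y1 ^+ 2); first by ring.
  by rewrite E1 E2; ring.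
have -> : b = y1 ^+ 2 - x1 ^+ 3 - a * x1 by rewrite E1; ring.
have -> : a = - (x1 ^+ 2 + x1 * x2 + x2 ^+ 2) - (l ^+ 2 * (x1 - x2) - 2 * l * y1).
  by rewrite El; ring.
by rewrite /x3; ring.
Qed.

Theorem theorem4p6 (t0 : nat) :
  (1 < t0)%N -> (t0 %% 4 = 1)%N ->
  forall (P1 P2 : option (Qt * Qt)) (R : option (rat * rat)),
    E_Qt P1 -> E_Qt P2 ->
    spec_rel (t0%:R) P1 R -> spec_rel (t0%:R) P2 R -> P1 = P2.
Proof.
move=> t01 t04 [[x1 y1]|] [[x2 y2]|] [[a b]|] //= E1 E2; last first.
- by move=> _ []; apply: kernel_trivial E2.
- by move=> []; case: (kernel_trivial t01 t04 E1) => c ?; exists c.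
- by move=> []; apply: kernel_trivial E1.
move=> [vx1 vy1] [vx2 vy2].
have vt : value_at t0%:R tQ t0%:R by have := value_at_poly t0%:R 'X; rewrite hornerX.
have nb : b != 0.
  have ot : odd t0 by clear -t04; lia.
  apply: contra_neq (cubic_no_rational_root a ot) => b0.
  have : value_at t0%:R (y1 ^+ 2) (a ^+ 3 + - t0%:R ^+ 2 * a + t0%:R ^+ 2).
    rewrite E1; apply: value_atD; last exact: value_atX.
    apply: value_atD; first exact: value_atX.
    by apply: value_atM => //; apply/value_atN/value_atX.
  by move/(value_at_uniq (value_atX 2 vy1)); rewrite b0 expr0n mulNr => <-.
have nbb : b + b != 0 by rewrite -mulr2n mulrn_eq0.
(* If x1 = x2, then y2 = y1 or y2 = - y1; the latter would give b = - b at t0. *)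
have [ex|nx] := eqVneq x1 x2.
  move: E2; rewrite -ex -E1 => /eqP; rewrite eqf_sqr => /orP[/eqP->//|/eqP ey].
  have := value_at_uniq vy2 (_ : value_at _ y2 (- b)); rewrite ey.
  move=> /(_ (value_atN vy1)) /eqP.
  by rewrite -subr_eq0 opprK (negbTE nbb).
(* The abscissa x3 of P2 - P1 has a value at t0, so (x1 - x2)^2 (x3 + x1 + x2) = (y1 + y2)^2
   specializes to 0 = (2 b)^2. *)
have [c vc] := kernel_trivial t01 t04 (chord_on_curve nx E1 E2).
have vl := value_atD (value_atD vc vx1) vx2.
have v0 := value_atM (value_atX 2 (value_atD vx1 (value_atN vx2))) vl.
have v1 := value_atX 2 (value_atD vy1 vy2).
have d0 : x1 - x2 != 0 by rewrite subr_eq0.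
have e : (x1 - x2) ^+ 2 * (((y1 + y2) / (x1 - x2)) ^+ 2 - x1 - x2 + x1 + x2)
         = (y1 + y2) ^+ 2.
  by rewrite addrAC subrK subrK -exprMn mulrC divfK.
rewrite e in v0; have := value_at_uniq v1 v0.
by move=> /eqP; rewrite subrr expr0n mul0r expf_eq0 (negbTE nbb).
Qed.
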